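(* Let $p\ge2$ and let $\mathcal D$ be a symmetric power law distribution with index $p$; let $\mathbf A\sim\mathcal D^{n\times d}$ have i.i.d. entries from $\mathcal D$. Let $\epsilon\in(0,1/2)$, let \[ r=\Theta\Big(\max\Big\{\epsilon^{-p},\ \big(d^{3/2+1/p}\epsilon^{-1}\log\epsilon^{-1}\big)^{p/(p-1)}\Big\}\Big), \] and let $\mathbf S\in\mathbb R^{r\times n}$ be a matrix that uniformly samples $r$ rows and scales them by $n/r$. Then \[ \Pr\big(\|\mathbf S\mathbf A\mathbf x\|_1=(1\pm O(\epsilon))\|\mathbf A\mathbf x\|_1,\ \forall\mathbf x\in\mathbb R^d\big)\ge 0.9 . \]
   Context: A symmetric power law distribution with index $p$ is a symmetric distribution on $\mathbb R$ with cdf $F$ satisfying $1-F(x)\sim c\,x^{-p}$ as $x\to\infty$ for some constant $c>0$. *)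

(* Defs.v *)
From HB Require Import structures.
From mathcomp Require Import all_boot all_order all_algebra.
From mathcomp Require Import all_classical all_reals all_analysis.

Set Implicit Arguments.
Unset Strict Implicit.
Unset Printing Implicit Defensive.

Import Order.TTheory GRing.Theory Num.Theory.
Import numFieldNormedType.Exports.

Local Open Scope classical_set_scope.
Local Open Scope ring_scope.

Definition cdf_of (R : realType) (D : probability (measurableTypeR R) R)
    (x : R) : R :=
  fine (D [set y : R | y <= x]).

Definition symmetric_distribution (R : realType)
    (D : probability (measurableTypeR R) R) : Prop :=
  forall B : set (measurableTypeR R), measurable B ->
    D [set y : R | B (- y)] = D B.

Definition symmetric_power_law (R : realType)
    (D : probability (measurableTypeR R) R) (p : R) : Prop :=
  symmetric_distribution D /\
  exists2 c : R, 0 < c &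
    (1 - cdf_of D x) / (c * x `^ (- p)) @[x --> +oo] --> (1 : R).

Definition has_law (disp : measure_display) (T : measurableType disp)
    (R : realType) (P : probability T R) (X : {RV P >-> measurableTypeR R})
    (D : probability (measurableTypeR R) R) : Prop :=
  forall B : set (measurableTypeR R), measurable B -> distribution P X B = D B.

Definition independent_classes (disp : measure_display)
    (T : measurableType disp) (R : realType) (P : probability T R)
    (I : finType) (F : I -> set (set T)) : Prop :=
  forall (J : {set I}) (E : I -> set T),
    (forall i, i \in J -> F i (E i)) ->
    P (\bigcap_(i in [set` J]) E i) = (\prod_(i in J) fine (P (E i)))%:E.

(* The sigma-algebra generated by a random variable X, resp. by a random
   element s of a finite type (all of whose subsets are measurable). *)
Definition sigma_RV (disp : measure_display) (T : measurableType disp)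
    (R : realType) (X : T -> measurableTypeR R) : set (set T) :=
  preimage_set_system setT X measurable.

Definition sigma_fin (T : Type) (U : finType) (s : T -> U) : set (set T) :=
  preimage_set_system setT s setT.

(* s lists the indices of r rows drawn from n rows uniformly without
   replacement: it is uniform on the n ^_ r injections from 'I_r to 'I_n.
   No such s exists when n < r. *)
Definition uniform_row_sample (disp : measure_display)
    (T : measurableType disp) (R : realType) (P : probability T R)
    (r n : nat) (s : T -> {ffun 'I_r -> 'I_n}) : Prop :=
  forall g : {ffun 'I_r -> 'I_n},
    measurable (s @^-1` [set g]) /\
    P (s @^-1` [set g]) =
      (if injectiveb g then ((n ^_ r)%:R^-1)%:E else 0%:E).

Definition sampling_mx (R : realType) (r n : nat)
    (g : {ffun 'I_r -> 'I_n}) : 'M[R]_(r, n) :=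
  \matrix_(k < r, i < n) (n%:R / r%:R * (g k == i)%:R).

(* Joint independence of the entries of A and of the sample s: the index None
   stands for s, so that s is also independent of A. *)
Definition iid_entries_indep_sample (disp : measure_display)
    (T : measurableType disp) (R : realType) (P : probability T R)
    (D : probability (measurableTypeR R) R) (r n d : nat)
    (A : 'I_n -> 'I_d -> {RV P >-> measurableTypeR R})
    (s : T -> {ffun 'I_r -> 'I_n}) : Prop :=
  (forall i j, has_law (A i j) D) /\
  independent_classes P (fun k : option ('I_n * 'I_d) =>
    if k is Some ij then sigma_RV (A ij.1 ij.2) else sigma_fin s).

Definition random_mx (disp : measure_display) (T : measurableType disp)
    (R : realType) (P : probability T R) (n d : nat)
    (A : 'I_n -> 'I_d -> {RV P >-> measurableTypeR R}) (t : T) : 'M[R]_(n, d) :=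
  \matrix_(i < n, j < d) A i j t.

Definition l1norm (R : realType) (m : nat) (v : 'cV[R]_m) : R :=
  \sum_(i < m) `|v i 0|.

Definition sample_size (R : realType) (p : R) (d : nat) (eps : R) : R :=
  Num.max (eps `^ (- p))
    ((d%:R `^ (3 / 2 + p^-1) * eps^-1 * ln (eps^-1)) `^ (p / (p - 1))).

(* Main.v *)
Require Import Defs.
From HB Require Import structures.
From mathcomp Require Import all_boot all_order all_algebra.
From mathcomp Require Import all_classical all_reals all_analysis.
From mathcomp Require Import measurable_realfun.
From mathcomp Require Import ring lra.
Set Implicit Arguments.
Unset Strict Implicit.
Unset Printing Implicit Defensive.
Import Order.TTheory GRing.Theory Num.Theory.
Import numFieldNormedType.Exports.
Local Open Scope classical_set_scope.
Local Open Scope ring_scope.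

(** Write [M x = \sum_i `|<a_i, x>|] for the row sum of a matrix with i.i.d.
    rows [a_i]. Conditionally on the sample, both the full matrix and the
    sampled rows have i.i.d. entries of law [D], so it suffices to show that
    [M x] is within a factor [1 +- O(eps)] of its mean, uniformly in [x].

    Symmetrization with a ghost sample and the contraction principle bound the
    expected supremum over the Euclidean unit ball of [`|M x - E M x|] by that
    of the linear process [\sum_i s_i <a_i, x>] with random signs [s_i], that
    is by the expected Euclidean norm of [\sum_i s_i a_i]. Splitting the
    entries at the level [d / eps] and using only the tail bound
    [D (|y| > t) <= C / t^2], this is [O (eps N)] for [N] rows as soon as
    [d^(3/2) ln (1/eps) = O (N eps^2)], and Markov's inequality applies.
    Khinchine's inequality and the symmetry of [D] give the matching lower
    bound [E M x >= c N |x|_2]. The sample size satisfies the requirement on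
    [N] because it bounds both [r^(1/p)] and [r^(1-1/p)] from below. *)

(** * Rademacher averages *)

(** Two obstacles shape the argument. At [p = 2] the second moment of [D] is infinite, so the mean
    of [M x] is bounded below through first moments only, by duality with Riesz products. Moreover
    the sampled sum is compared with the random [M x] of the full matrix, with one constant for all
    [eps < 1/2]. Once the allowed error exceeds 1 the lower estimate is void, but the upper one
    still needs [M x] not to fall far below its mean. For large [n] this follows from concentration
    at a fixed precision; otherwise [n / r] is bounded, and the sampled rows are among the rows of
    the matrix.

    The scaling [n / r] gives both sums the same mean, and drawing rows without replacement keeps
    the sampled rows independent.

    No supremum over the ball is formed. Finite maxima are used, with a maximizer chosen for each
    sign pattern; the bound does not depend on the number of vectors, so it passes to an enumeration
    of rational directions, and then to all [x] by continuity. *)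

Section rademacher.
Context {R : realType} {I : finType}.
Implicit Types (s : {ffun I -> bool}) (i : I).

Definition sg s i : R := (-1) ^+ s i.

Definition flip i s : {ffun I -> bool} := [ffun k => (k == i) (+) s k].

Lemma flipK i : involutive (flip i).
Proof. by move=> s; apply/ffunP => k; rewrite !ffunE addbA addbb. Qed.

Lemma sg_flip i s k : sg (flip i s) k = if k == i then - sg s k else sg s k.
Proof. by rewrite /sg ffunE; case: eqP => // _; rewrite addTb signrN. Qed.

Lemma sg_sqr s i : sg s i * sg s i = 1.
Proof. by rewrite -expr2 /sg sqrr_sign. Qed.

Lemma normr_sg s i : `|sg s i| = 1.
Proof. by rewrite /sg normr_sign. Qed.

Lemma sum_flip i (f : {ffun I -> bool} -> R) :
  \sum_s f (flip i s) = \sum_s f s.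
Proof.
by rewrite [RHS](reindex_inj (h := flip i)) //; exact: inv_inj (flipK i).
Qed.

(** The terms of [s] and [flip i s] cancel; mixed terms in random signs vanish this way. *)
Lemma sum_sg0 i (f : {ffun I -> bool} -> R) :
  (forall s, f (flip i s) = f s) -> \sum_s sg s i * f s = 0.
Proof.
move=> fi; have : \sum_s sg s i * f s = - \sum_s sg s i * f s.
  rewrite -{1}(sum_flip i) -sumrN; apply: eq_bigr => s _.
  by rewrite sg_flip eqxx fi mulNr.
lra.
Qed.

Lemma sum_sg_sqr (b : I -> R) :
  \sum_s (\sum_i sg s i * b i) ^+ 2 =
    #|{: {ffun I -> bool}}|%:R * \sum_i b i ^+ 2.
Proof.
rewrite (eq_bigr (fun s => \sum_i \sum_k (sg s i * b i) * (sg s k * b k)));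
  last by move=> s _; rewrite expr2 mulr_suml; apply: eq_bigr => i _;
    rewrite mulr_sumr.
rewrite exchange_big mulr_sumr /=; apply: eq_bigr => i _.
rewrite exchange_big /= (bigD1 i) //= [X in _ + X]big1 => [|k ki].
  rewrite addr0 (eq_bigr (fun=> b i ^+ 2)).
    by rewrite sumr_const mulr_natl.
  by move=> s _; rewrite mulrACA sg_sqr mul1r expr2.
rewrite (eq_bigr (fun s => sg s i * (sg s k * (b i * b k)))); last first.
  by move=> s _; rewrite mulrACA -mulrA.
by apply: sum_sg0 => s; rewrite sg_flip (negPf ki).
Qed.

(* The step of the Ledoux-Talagrand contraction principle: for the pair
   [s], [flip i s] one has [|t v| - |t w| <= |t v - t w|], and the right-hand
   side is reached by exchanging the two choices if necessary. *)
Lemma contraction_step (V : Type) (Q : V -> Prop) i (t : V -> R)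
    (h : {ffun I -> bool} -> V -> R) (y : {ffun I -> bool} -> V) :
  (forall s v, h (flip i s) v = h s v) -> (forall s, Q (y s)) ->
  exists2 y' : {ffun I -> bool} -> V, (forall s, Q (y' s)) &
    \sum_s (h s (y s) + sg s i * `|t (y s)|) <=
      \sum_s (h s (y' s) + sg s i * t (y' s)).
Proof.
move=> hi Qy.
(* The test depends only on the pair [s], [flip i s]: both members exchange together, and the [h]
   terms, equal on the pair, keep their sum. After the exchange the larger value of [t] carries the
   sign [+1]. *)
pose swap s := if s i then t (y (flip i s)) < t (y s)
               else t (y s) < t (y (flip i s)).
have swapE s : swap (flip i s) = swap s.
  by rewrite /swap flipK ffunE eqxx addTb; case: (s i).
exists (fun s => if swap s then y (flip i s) else y s).
  by move=> s; case: ifP.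
have half (f : {ffun I -> bool} -> R) :
    \sum_s f s = 2^-1 * \sum_s (f s + f (flip i s)).
  by rewrite big_split /= sum_flip; lra.
rewrite half [leRHS]half ler_pM2l ?invr_gt0 //; apply: ler_sum => s _.
rewrite swapE flipK !hi !sg_flip eqxx /swap /sg.
set v := y s; set w := y (flip i s).
have nvw : `|t v| - `|t w| <= `|t v - t w| by apply: lerB_dist.
have nwv : `|t w| - `|t v| <= `|t v - t w| by rewrite distrC; apply: lerB_dist.
case: (s i); rewrite ?expr1 ?expr0 ?opprK ?mulN1r ?mul1r.
  case: ltP => tvw; move: nwv.
    by rewrite (@gtr0_norm _ (t v - t w)) ?subr_gt0 //; lra.
  by rewrite (@ler0_norm _ (t v - t w)) ?subr_le0 //; lra.
case: ltP => tvw; move: nvw.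
  by rewrite (@ltr0_norm _ (t v - t w)) ?subr_lt0 //; lra.
by rewrite (@ger0_norm _ (t v - t w)) ?subr_ge0 //; lra.
Qed.

(** Absolute values are removed one index at a time. A point [y s] chosen for each sign pattern
    stands for the supremum over [Q], which need not be attained. *)
Lemma contraction (V : Type) (Q : V -> Prop) (t : I -> V -> R)
    (y : {ffun I -> bool} -> V) : (forall s, Q (y s)) ->
  exists2 y' : {ffun I -> bool} -> V, (forall s, Q (y' s)) &
    \sum_s \sum_i sg s i * `|t i (y s)| <= \sum_s \sum_i sg s i * t i (y' s).
Proof.
move=> Qy; pose val (l : seq I) i v := if i \in l then t i v else `|t i v|.
suff /(_ (enum I)) : forall l : seq I, uniq l ->
    exists2 y' : {ffun I -> bool} -> V, (forall s, Q (y' s)) &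
      \sum_s \sum_i sg s i * `|t i (y s)| <=
        \sum_s \sum_i sg s i * val l i (y' s).
  case; first exact: enum_uniq.
  move=> y' Qy' le; exists y' => //; apply: le_trans le _.
  apply: ler_sum => s _; apply: ler_sum => i _.
  by rewrite /val mem_enum.
elim => [_|i l IHl /= /andP[il /IHl[y1 Qy1 le1]]]; first by exists y.
pose h s v := \sum_(k | k != i) sg s k * val l k v.
have [|y2 Qy2 le2] := @contraction_step V Q i (t i) h y1 _ Qy1.
  move=> s v; apply: eq_bigr => k ki.
  by rewrite sg_flip (negPf ki).
exists y2 => //; apply: le_trans le1 (le_trans _ (le_trans le2 _)).
  apply: ler_sum => s _; rewrite (bigD1 i) //= addrC.
  by rewrite /val (negPf il) lexx.
apply: ler_sum => s _; rewrite [leRHS](bigD1 i) //= [leRHS]addrC /val mem_head lerD2r.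
by apply: ler_sum => k ki; rewrite inE (negPf ki).
Qed.

(* Real and imaginary parts of the Riesz product [\prod_j (1 + i s_j w_j)]. *)
Fixpoint riesz (w : I -> R) (l : seq I) s : R * R :=
  if l is i :: l' then
    let: (a, b) := riesz w l' s in
    (a - sg s i * w i * b, b + sg s i * w i * a)
  else (1, 0).

Lemma riesz_flip w l i s : i \notin l -> riesz w l (flip i s) = riesz w l s.
Proof.
elim: l => // k l IHl /=; rewrite inE negb_or => /andP[ik /IHl ->].
by case: riesz => a b; rewrite sg_flip eq_sym (negPf ik).
Qed.

(** Each factor has squared modulus [1 + w_i ^+ 2] whatever its sign, so the product is bounded
    uniformly in [s]. *)
Lemma riesz_norm w l s :
  (riesz w l s).1 ^+ 2 + (riesz w l s).2 ^+ 2 = \prod_(i <- l) (1 + w i ^+ 2).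
Proof.
elim: l => [|i l IHl] /=; first by rewrite big_nil; ring.
rewrite big_cons -IHl; case: riesz => a b /=.
have := sg_sqr s i; set e := sg s i => e1.
have -> : (a - e * w i * b) ^+ 2 + (b + e * w i * a) ^+ 2 =
  (1 + (e * e) * w i ^+ 2) * (a ^+ 2 + b ^+ 2) by ring.
by rewrite e1 mul1r.
Qed.

Lemma sum_riesz1 w l : uniq l ->
  \sum_s (riesz w l s).1 = #|{: {ffun I -> bool}}|%:R.
Proof.
elim: l => [_|i l IHl /= /andP[il ul]] /=; first by rewrite sumr_const.
rewrite -IHl //.
rewrite (eq_bigr (fun s => (riesz w l s).1 - sg s i * (w i * (riesz w l s).2))).
  rewrite sumrB [X in _ - X]sum_sg0 ?subr0 // => s.
  by rewrite riesz_flip.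
by move=> s _; case: riesz => a b /=; rewrite mulrA.
Qed.

(** Averaging [s_k] times the product turns factor [k] into [w_k] times the imaginary unit and every
    other factor into 1. *)
Lemma sum_riesz2 w t l : uniq l ->
  \sum_s (\sum_(i <- l) sg s i * t i) * (riesz w l s).2 =
    #|{: {ffun I -> bool}}|%:R * \sum_(i <- l) t i * w i.
Proof.
elim: l => [_|i l IHl /= /andP[il ul]] /=.
  by rewrite big_nil mulr0 big1 // => s _; rewrite mulr0.
(* Since the square of [s_i] is 1, the expansion splits into terms free of [s_i] and a multiple of
   [s_i], which averages to 0. *)
rewrite (eq_bigr (fun s => (\sum_(i <- l) sg s i * t i) * (riesz w l s).2
   + t i * w i * (riesz w l s).1 + sg s i * (t i * (riesz w l s).2
    + w i * (\sum_(i <- l) sg s i * t i) * (riesz w l s).1))).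
  rewrite !big_split /= IHl // -mulr_sumr sum_riesz1 // sum_sg0 => [|s].
    by rewrite big_cons; ring.
  rewrite riesz_flip //; congr (_ + _ * _ * _).
  rewrite big_seq [RHS]big_seq; apply: eq_bigr => k kl.
  by rewrite sg_flip; case: eqP kl il => // -> ->.
move=> s _; case: riesz => a b; rewrite big_cons /=.
have := sg_sqr s i; set e := sg s i; set S := \sum_(_ <- _) _ => e1.
have -> : (e * t i + S) * (b + e * w i * a) = S * b + (e * e) * (t i * w i * a)
   + e * (t i * b + w i * S * a) by ring.
by rewrite e1 mul1r.
Qed.

Lemma prod_le_expR (x : I -> R) l : (forall i, 0 <= x i) ->
  \prod_(i <- l) (1 + x i) <= expR (\sum_(i <- l) x i).
Proof.
move=> x0; elim: l => [|i l IHl]; first by rewrite !big_nil expR0.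
rewrite !big_cons expRD ler_pM ?addr_ge0 ?expR_ge1Dx //.
by rewrite prodr_ge0 // => k _; rewrite addr_ge0.
Qed.

(** The Rademacher sum is tested against the imaginary part of the Riesz product, whose square is at
    most [expR 1 <= 4]; hence the factor 2. *)
Lemma khinchine (t w : I -> R) : \sum_i w i ^+ 2 <= 1 ->
  #|{: {ffun I -> bool}}|%:R * \sum_i t i * w i <=
    2 * \sum_s `|\sum_i sg s i * t i|.
Proof.
move=> w1; rewrite -big_enum -sum_riesz2 ?enum_uniq // mulr_sumr.
apply: ler_sum => s _; rewrite -big_enum /=.
apply: le_trans (ler_norm _) _; rewrite normrM mulrC ler_wpM2r //.
have := riesz_norm w (enum I) s; set b := (riesz _ _ _).2.
have : \prod_(i <- enum I) (1 + w i ^+ 2) <= 4.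
  apply: le_trans (prod_le_expR _ _) _ => [i|]; first exact: sqr_ge0.
  rewrite big_enum /=; apply: (@le_trans _ _ (expR 1)); first by rewrite ler_expR.
  have h2 : expR (2^-1) <= 2 :> R.
    have := expR_ge1Dx (- 2^-1 : R); rewrite expRN.
    have e0 := expR_gt0 (2^-1 : R) => le; rewrite -[leRHS]invrK.
    by rewrite -[leLHS]invrK lef_pV2 ?posrE ?invr_gt0 //; lra.
  have e0 := expR_gt0 (2^-1 : R).
  have -> : expR 1 = expR (2^-1) * expR (2^-1) :> R.
    by rewrite -expRD; congr expR; lra.
  have := ler_pM (ltW e0) (ltW e0) h2 h2; lra.
move=> le4 e; rewrite ler_norml -ler_norml -(ler_pXn2r (ltn0Sn 1)) ?nnegrE //.
rewrite real_normK ?num_real //; have := sqr_ge0 (riesz w (enum I) s).1; lra.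
Qed.

(** After contraction, the [b] part is paired with the chosen point [z] by
    [B z <= B^2 / (2 q) + q z^2 / 2], so only its mean square matters; the [e] part uses
    [|z_j| <= 1]. The free parameter [q] later becomes [N eps]. *)
Lemma rademacher_bound (J : finType) (b e : I -> J -> R) (q : R)
    (y : {ffun I -> bool} -> J -> R) :
  0 < q -> (forall s, \sum_j y s j ^+ 2 <= 1) ->
  \sum_s \sum_i sg s i * `|\sum_j (b i j + e i j) * y s j| <=
    #|{: {ffun I -> bool}}|%:R *
      (q / 2 + \sum_i \sum_j (b i j ^+ 2 / (2 * q) + `|e i j|)).
Proof.
move=> q0 y1.
have [z z1 le] := @contraction (J -> R) (fun v => \sum_j v j ^+ 2 <= 1)
  (fun i v => \sum_j (b i j + e i j) * v j) y y1.
apply: le_trans le _.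
pose B s j := \sum_i sg s i * b i j.
have cst (c : R) : \sum_(s : {ffun I -> bool}) c =
    #|{: {ffun I -> bool}}|%:R * c by rewrite sumr_const mulr_natl.
have B2 : \sum_s \sum_j B s j ^+ 2 / (2 * q) =
    #|{: {ffun I -> bool}}|%:R * \sum_i \sum_j b i j ^+ 2 / (2 * q).
  rewrite exchange_big [in RHS]exchange_big mulr_sumr /=.
  by apply: eq_bigr => j _; rewrite -!mulr_suml sum_sg_sqr mulrA.
move: cst B2; set N : R := #|_|%:R => cst B2.
have -> : N * (q / 2 + \sum_i \sum_j (b i j ^+ 2 / (2 * q) + `|e i j|)) =
    \sum_s (q / 2 + \sum_j B s j ^+ 2 / (2 * q) + \sum_i \sum_j `|e i j|).
  rewrite big_split cst big_split /= cst B2 -!mulrDr -addrA -big_split /=.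
  by congr (_ * (_ + _)); apply: eq_bigr => i _; rewrite big_split.
apply: ler_sum => s _.
have -> : \sum_i sg s i * (\sum_j (b i j + e i j) * z s j) =
    \sum_j B s j * z s j + \sum_i \sum_j sg s i * e i j * z s j.
  rewrite (eq_bigr (fun i => \sum_j sg s i * b i j * z s j +
                             \sum_j sg s i * e i j * z s j)) => [|i _].
    rewrite big_split /= exchange_big /=; congr (_ + _).
    by apply: eq_bigr => j _; rewrite mulr_suml.
  by rewrite mulr_sumr -big_split /=; apply: eq_bigr => j _; ring.
apply: lerD.
  rewrite addrC -[q / 2]mulr1.
  apply: (@le_trans _ _ (\sum_j (B s j ^+ 2 / (2 * q) + q / 2 * z s j ^+ 2))).
    apply: ler_sum => j _; rewrite -subr_ge0.
    rewrite (_ : _ - _ = (B s j - q * z s j) ^+ 2 / (2 * q)).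
      by rewrite divr_ge0 ?sqr_ge0 // mulr_ge0 // ltW.
    by field; rewrite gt_eqF.
  by rewrite big_split /= lerD2l -mulr_sumr ler_wpM2l // divr_ge0 // ltW.
apply: ler_sum => i _; apply: ler_sum => j _.
apply: le_trans (ler_norm _) _; rewrite !normrM normr_sg mul1r.
rewrite -[leRHS]mulr1 ler_wpM2l //.
rewrite -(ler_pXn2r (ltn0Sn 1)) ?nnegrE // expr1n real_normK ?num_real //.
apply: le_trans (z1 s); rewrite (bigD1 j) //= lerDl.
by apply: sumr_ge0 => k _; rewrite sqr_ge0.
Qed.

End rademacher.

(** * I.i.d. families *)

Section iid_family.
Context {R : realType} (D : probability (measurableTypeR R) R).

(** One product formula over all of [K] encodes both independence and the common law: taking [B k]
    to be the whole space for some [k] recovers subfamilies. *)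
Definition iid_family (disp : measure_display) (T : measurableType disp)
    (P : probability T R) (K : finType) (X : K -> T -> measurableTypeR R) : Prop :=
  (forall k, measurable_fun setT (X k)) /\
  forall B : K -> set (measurableTypeR R), (forall k, measurable (B k)) ->
    P (\bigcap_k (X k @^-1` B k)) = (\prod_k fine (D (B k)))%:E.

Lemma iid_inj (disp : measure_display) (T : measurableType disp)
    (P : probability T R) (K L : finType) (X : K -> T -> measurableTypeR R)
    (h : L -> K) :
  injective h -> iid_family P X -> iid_family P (fun l => X (h l)).
Proof.
move=> hinj [mX iX]; split => // B mB.
(* A fibre of [h] has at most one point, so [B' k] is [B l] at [k = h l] and the whole space off the
   range of [h]. *)
pose B' k := \bigcap_(l in [set l | h l = k]) B l.
have B'h l : B' (h l) = B l.
  apply/seteqP; split=> [y /(_ l erefl)//|y By l' /hinj -> //].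
have B'N k : k \notin codom h -> B' k = setT.
  move=> kh; apply/seteqP; split=> // y _ l hl.
  by move: kh; rewrite -hl codom_f.
have mB' k : measurable (B' k).
  have [/codomP[l ->]|/B'N ->] := boolP (k \in codom h); last exact: measurableT.
  by rewrite B'h.
have -> : \bigcap_l (X (h l) @^-1` B l) = \bigcap_k (X k @^-1` B' k).
  apply/seteqP; split=> [t Bt k _ l <-|t Bt l _]; first exact: Bt.
  by have := Bt (h l) I; rewrite /= B'h.
rewrite iX //; congr EFin.
rewrite (bigID (fun k => k \in h @: [set: L]%SET)) /= [X in _ * X]big1 ?mulr1.
  rewrite big_imset /=; last by move=> ? ? _ _; exact: hinj.
  by apply: eq_big => [l|l _]; rewrite ?finset.in_setT ?B'h.
move=> k kh; rewrite B'N ?probability_setT //.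
apply: contra kh => /codomP[l ->]; by apply/imsetP; exists l.
Qed.

Lemma iid_flip (disp : measure_display) (T : measurableType disp)
    (P : probability T R) (K : finType) (X : K -> T -> measurableTypeR R)
    (e : K -> bool) : symmetric_distribution D ->
  iid_family P X -> iid_family P (fun k t => (-1) ^+ e k * X k t).
Proof.
move=> sD [mX iX]; split=> [k|B mB].
  by apply: measurable_funM => //; exact: mX.
pose B' k := [set y : R | B k ((-1) ^+ e k * y)].
have mB' k : measurable (B' k).
  rewrite -[B' k]setTI.
  have : measurable_fun setT (fun y : measurableTypeR R => (-1) ^+ e k * y).
    exact: measurable_funM.
  by move=> /(_ measurableT _ (mB k)).
have -> : \bigcap_k ((fun t => (-1) ^+ e k * X k t) @^-1` B k) =
  \bigcap_k (X k @^-1` B' k) by [].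
rewrite iX //; congr EFin; apply: eq_bigr => k _; congr fine.
rewrite /B'; case: (e k).
  rewrite -[RHS]sD //; congr (D _); apply/funext => y /=.
  by rewrite expr1 mulN1r.
by congr (D _); apply/funext => y /=; rewrite expr0 mul1r.
Qed.

Lemma iid_prod (disp1 disp2 : measure_display) (T1 : measurableType disp1)
    (T2 : measurableType disp2) (P1 : probability T1 R) (P2 : probability T2 R)
    (K1 K2 : finType) (X : K1 -> T1 -> measurableTypeR R)
    (Y : K2 -> T2 -> measurableTypeR R) :
  iid_family P1 X -> iid_family P2 Y ->
  iid_family (P1 \x P2)%E (fun (k : K1 + K2) (t : T1 * T2) =>
    match k with inl i => X i t.1 | inr j => Y j t.2 end).
Proof.
move=> [mX iX] [mY iY]; split=> [[k|k]|B mB].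
- exact: measurableT_comp (mX k) measurable_fst.
- exact: measurableT_comp (mY k) measurable_snd.
have -> : \bigcap_k ((fun t : T1 * T2 =>
      match k with inl i => X i t.1 | inr j => Y j t.2 end) @^-1` B k) =
    (\bigcap_k (X k @^-1` B (inl k))) `*` (\bigcap_k (Y k @^-1` B (inr k))).
  apply/seteqP; split=> [[t1 t2] Bt|[t1 t2] [/= B1 B2] [k|k] _].
  - by split=> k _; [exact: (Bt (inl k))|exact: (Bt (inr k))].
  - exact: B1.
  - exact: B2.
rewrite [LHS]product_measure1E.
- rewrite [X in (X * _)%E](iX (fun k => B (inl k))) //.
  by rewrite [X in (_ * X)%E](iY (fun k => B (inr k))) // -EFinM big_sumType.
- apply: fin_bigcap_measurable => [|k _]; first exact: finite_finset.
  by rewrite -[X in measurable X]setTI; exact: mX.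
- apply: fin_bigcap_measurable => [|k _]; first exact: finite_finset.
  by rewrite -[X in measurable X]setTI; exact: mY.
Qed.

(** Tuples carry the product sigma-algebra on which joint laws are compared. *)
Definition fam (K : finType) (w : #|K|.-tuple (measurableTypeR R)) (k : K) : R :=
  tnth w (enum_rank k).

Lemma measurable_fam (K : finType) (k : K) :
  measurable_fun setT ((@fam K)^~ k).
Proof. exact: measurable_tnth. Qed.

(** Both joint laws, pushed to tuples, agree on boxes, which form a generating pi-system. Sign
    flips, ghost swaps and the comparison of rows all rest on this. *)
Lemma iid_integral (disp1 disp2 : measure_display) (T1 : measurableType disp1)
    (T2 : measurableType disp2) (P1 : probability T1 R) (P2 : probability T2 R)
    (K : finType) (X : K -> T1 -> measurableTypeR R)
    (Y : K -> T2 -> measurableTypeR R) (h : (K -> R) -> \bar R) :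
  iid_family P1 X -> iid_family P2 Y ->
  measurable_fun setT (fun w => h (@fam K w)) -> (forall z, 0 <= h z)%E ->
  (\int[P1]_t h (fun k => X k t) = \int[P2]_t h (fun k => Y k t))%E.
Proof.
move=> iidX iidY mh h0.
pose tup (S : Type) (Z : K -> S -> measurableTypeR R) (t : S) :=
  [tuple Z (enum_val i) t | i < #|K|].
have tupE S (Z : K -> S -> measurableTypeR R) t :
    h (fun k => Z k t) = h (fam (tup S Z t)).
  by congr h; apply/funext => k; rewrite /fam tnth_mktuple enum_rankK.
have mtup d (S : measurableType d) (Z : K -> S -> measurableTypeR R) :
    (forall k, measurable_fun setT (Z k)) -> measurable_fun setT (tup S Z).
  move=> mZ; apply/measurable_fun_tnthP => i.
  rewrite (_ : _ \o _ = Z (enum_val i)) //.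
  by apply/funext => t /=; rewrite tnth_mktuple.
have mtX := mtup _ _ _ iidX.1; have mtY := mtup _ _ _ iidY.1.
under eq_integral do rewrite tupE.
under [RHS]eq_integral do rewrite tupE.
have := ge0_integral_pushforward mtX P1 measurableT mh (fun z _ => h0 _).
rewrite preimage_setT => <-.
have := ge0_integral_pushforward mtY P2 measurableT mh (fun z _ => h0 _).
rewrite preimage_setT => <-.
apply: eq_measure_integral => A mA _.
pose cyl := [set C : set (#|K|.-tuple (measurableTypeR R)) |
  exists2 B : K -> set (measurableTypeR R), (forall k, measurable (B k)) &
    C = \bigcap_k ((@fam K)^~ k @^-1` B k)].
have cylE d (S : measurableType d) (Z : K -> S -> measurableTypeR R)
    (B : K -> set (measurableTypeR R)) :
  tup S Z @^-1` (\bigcap_k ((@fam K)^~ k @^-1` B k)) =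
    \bigcap_k (Z k @^-1` B k).
  rewrite preimage_bigcap; apply: eq_bigcapr => k _.
  by rewrite /preimage; apply/funext => t /=; rewrite /fam tnth_mktuple enum_rankK.
have mcyl C : cyl C -> measurable C.
  move=> [B mB ->]; apply: fin_bigcap_measurable => [|k _].
    exact: finite_finset.
  rewrite -[X in measurable X]setTI.
  by have /(_ measurableT _ (mB k)) := measurable_fam k.
apply: (measure_unique cyl (fun=> setT)) => //.
- apply/seteqP; split.
    rewrite -[X in X `<=` _]/(g_sigma_preimage
      (fun i (w : #|K|.-tuple (measurableTypeR R)) => tnth w i)).
    apply: smallest_sub; first exact: smallest_sigma_algebra.
    move=> C; rewrite -bigcup_seq => -[i _ [B mB <-]].
    apply: sub_sigma_algebra.
    exists (fun k => if enum_rank k == i then B else setT) => [k|].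
      by case: ifP.
    rewrite setTI; apply/seteqP; split=> [w Bw k _ /=|w /(_ (enum_val i) I)].
      by rewrite /fam; case: eqP => // ->.
    by rewrite /= /fam enum_valK eqxx.
  apply: smallest_sub; [exact: sigma_algebra_measurable|exact: mcyl].
- move=> _ _ [B mB ->] [C mC ->]; exists (fun k => B k `&` C k) => [k|].
    exact: measurableI.
  by rewrite -bigcapI; apply: eq_bigcapr => k _; rewrite preimage_setI.
- move=> n; exists (fun=> setT) => // ; apply/seteqP; split => //.
- by rewrite bigcup_const //; exists 0%N.
- move=> C [B mB ->]; rewrite /= /pushforward !cylE iidX.2 // iidY.2 //.
- by move=> n; rewrite /= /pushforward preimage_setT probability_setT ltry.
Qed.

End iid_family.

(** * Truncated moments of a power law *)

Section tails.
Context {R : realType}.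
Local Notation RT := (measurableTypeR R).

Lemma dyadic (x : R) : 1 < x -> exists k : nat, 2 ^+ k < x <= 2 ^+ k.+1.
Proof.
move=> x1; have : exists n, x <= 2 ^+ n.
  exists (Num.Def.trunc x).+1; apply: ltW; apply: lt_trans (truncnS_gt x) _.
  by rewrite -natrX ltr_nat ltn_expl.
case/ex_minnP => -[|k] xk kmin; first by rewrite expr0 leNgt x1 in xk.
exists k; rewrite xk andbT ltNge; apply/negP => /kmin.
by rewrite ltnn.
Qed.

Lemma measurable_abs : measurable_fun [set: RT] (fun y : R => `|y|).
Proof. exact: measurableT_comp. Qed.

Definition abs_gt (t : R) : set RT := [set y | t < `|y|].

Lemma measurable_tail (t : R) : measurable (abs_gt t).
Proof.
rewrite /abs_gt -preimage_itvoy -[X in measurable X]setTI.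
exact: (measurable_abs measurableT (measurable_itv _)).
Qed.

Variables (D : probability RT R) (C : R).
Hypothesis C0 : 0 <= C.
Hypothesis tailD : forall t : R, 0 < t -> (D (abs_gt t) <= (C / t ^+ 2)%:E)%E.

Definition trunc_hi (M : R) (y : RT) : R := y * \1_(abs_gt M) y.
Definition trunc_lo (M : R) (y : RT) : R := y * \1_(~` (abs_gt M)) y.

Lemma trunc_add M y : trunc_lo M y + trunc_hi M y = y.
Proof.
rewrite -mulrDr /trunc_lo !indicE in_setC.
by case: (_ \in _); rewrite ?addr0 ?add0r mulr1.
Qed.

Lemma measurable_trunc_hi M : measurable_fun setT (trunc_hi M).
Proof.
by apply: measurable_funM => //; apply: measurable_indic; exact: measurable_tail.
Qed.

Lemma measurable_trunc_lo M : measurable_fun setT (trunc_lo M).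
Proof.
apply: measurable_funM => //; apply: measurable_indic.
by apply: measurableC; exact: measurable_tail.
Qed.

Lemma integral_tail (a t : R) : 0 <= a -> 0 < t ->
  (\int[D]_y (a * \1_(abs_gt t) y)%:E <= (a * (C / t ^+ 2))%:E)%E.
Proof.
move=> a0 t0; under eq_integral do rewrite EFinM.
rewrite ge0_integralZl_EFin //.
- rewrite integral_indic //; last exact: measurable_tail.
  by rewrite setIT EFinM lee_wpmul2l ?lee_fin // tailD.
- by apply/measurable_EFinP; apply: measurable_indic; exact: measurable_tail.
Qed.

Lemma measurable_scaled_tail (a t : R) : measurable_fun setT
  (fun y => (a * \1_(abs_gt t) y)%:E).
Proof.
apply/measurable_EFinP; apply: measurable_funM => //.
by apply: measurable_indic; exact: measurable_tail.
Qed.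

(** On the layer between [2^k M] and [2^(k+1) M] the entry is at most [2^(k+1) M], while the tail at
    its lower end is at most [C / (4^k M^2)]. The resulting geometric series sums to [4 C / M]. *)
Lemma integral_trunc_hi M : 0 < M ->
  (\int[D]_y (`|trunc_hi M y|)%:E <= (4 * C / M)%:E)%E.
Proof.
move=> M0.
pose f k (y : RT) : \bar R :=
  (2 ^+ k.+1 * M * \1_(abs_gt (2 ^+ k * M)) y)%:E.
have f0 k y : (0 <= f k y)%E.
  by rewrite lee_fin !mulr_ge0 // ?exprn_ge0 // ltW.
have fle (y : RT) : ((`|trunc_hi M y|)%:E <= \sum_(k <oo) f k y)%E.
  have [My|yM] := ltP M `|y|; last first.
    rewrite /trunc_hi indicE memNset /=; last by rewrite /abs_gt /= ltNge yM.
    by rewrite mulr0 normr0; apply: nneseries_ge0.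
  have [k /andP[ky yk]] : exists k : nat, 2 ^+ k < `|y| / M <= 2 ^+ k.+1.
    by apply: dyadic; rewrite ltr_pdivlMr // mul1r.
  (* The partial sum up to [k.+1] is the first one that contains the layer [k] of [y]. *)
  apply: le_trans (nneseries_lim_ge k.+1 _); last by [].
  rewrite big_nat_recr //= /f indicE mem_set /=; last first.
    by rewrite /abs_gt /= -ltr_pdivlMr.
  rewrite -[leLHS]add0e; apply: leeD.
    by apply: sume_ge0 => i _; exact: f0.
  rewrite lee_fin mulr1 /trunc_hi indicE mem_set // mulr1.
  by rewrite -ler_pdivrMr.
apply: (@le_trans _ _ (\int[D]_y \sum_(k <oo) f k y)%E).
  apply: ge0_le_integral => //.
  - apply/measurable_EFinP; apply: measurableT_comp => //.
    exact: measurable_trunc_hi.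
  - apply: ge0_emeasurable_sum => // k _; exact: measurable_scaled_tail.
rewrite integral_nneseries //; last by move=> k; exact: measurable_scaled_tail.
apply: le_trans (epsilon_trick0 predT _) => //; last first.
  by rewrite divr_ge0 ?mulr_ge0 // ltW.
apply: lee_nneseries => [k _ _|k _]; first exact: integral_ge0.
apply: le_trans (integral_tail _ _) _.
- by rewrite mulr_ge0 ?exprn_ge0 // ltW.
- by rewrite mulr_gt0 // exprn_gt0.
have k2 : (2 ^+ k : R) != 0 by rewrite expf_neq0.
rewrite lee_fin le_eqVlt; apply/orP; left; apply/eqP.
rewrite natrX !exprS; field.
by rewrite k2 gt_eqF.
Qed.

(** Values at most 1 contribute at most 1, and each dyadic layer contributes at most
    [4^(k+1) * C / 4^k = 4 C]. Only [L + 1] layers meet the range up to [M], where [L] is the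
    integer part of the binary logarithm of [M]. *)
Lemma integral_trunc_lo M : 1 <= M ->
  (\int[D]_y (trunc_lo M y ^+ 2)%:E <= (1 + 4 * C * (ln M / ln 2 + 1))%:E)%E.
Proof.
move=> M1.
have M0 : 0 < M by apply: lt_le_trans M1.
have ln2 : 0 < ln 2 :> R by rewrite ln_gt0 // ltr1n.
pose L := Num.Def.trunc (ln M / ln 2).
have LM : L%:R <= ln M / ln 2 < L.+1%:R.
  by apply: truncn_itv; apply: divr_ge0 (ln_ge0 M1) (ltW ln2).
have ML : M < 2 ^+ L.+1.
  rewrite -ltr_ln ?posrE ?exprn_gt0 // lnXn // -(mulr_natl (ln 2)) -ltr_pdivrMr //.
  by case/andP: LM.
pose f k (y : RT) : \bar R :=
  (4 ^+ k.+1 * \1_(abs_gt (2 ^+ k)) y)%:E.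
have f0 k y : (0 <= f k y)%E by rewrite lee_fin mulr_ge0 // exprn_ge0.
have mf k : measurable_fun setT (f k) by exact: measurable_scaled_tail.
have fle (y : RT) :
    ((trunc_lo M y ^+ 2)%:E <= 1 + \sum_(k < L.+1) f k y)%E.
  have s0 : (0 <= \sum_(k < L.+1) f k y)%E by apply: sume_ge0.
  have [yM|My] := leP `|y| M; last first.
    rewrite /trunc_lo indicE in_setC mem_set //= mulr0 expr0n /=.
    by rewrite adde_ge0.
  have -> : trunc_lo M y ^+ 2 = `|y| ^+ 2.
    rewrite /trunc_lo indicE in_setC memNset //= ?mulr1 ?real_normK ?num_real //.
    by rewrite /abs_gt /= ltNge yM.
  have [y1|y1] := leP `|y| 1.
    apply: (@le_trans _ _ 1%E); last by rewrite leeDl.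
    by rewrite lee_fin exprn_ile1.
  have [k /andP[ky yk]] := dyadic y1.
  have kL : (k < L.+1)%N.
    rewrite -(@ltr_eXn2l _ (2 : R)) ?ltr1n //.
    by apply: lt_trans ky _; apply: le_lt_trans yM ML.
  rewrite (bigD1 (Ordinal kL)) //= addeCA -[leLHS]adde0; apply: leeD.
    rewrite /f indicE mem_set //= mulr1 lee_fin.
    rewrite (_ : 4 = 2 ^+ 2) -?exprM; last by rewrite -natrX.
    by rewrite mulnC exprM ler_pXn2r // nnegrE ?exprn_ge0.
  by rewrite adde_ge0 // sume_ge0.
apply: (@le_trans _ _ (\int[D]_y (1 + \sum_(k < L.+1) f k y))%E).
  apply: ge0_le_integral => //.
  - by move=> y _; rewrite lee_fin sqr_ge0.
  - apply/measurable_EFinP; apply: measurable_funX; exact: measurable_trunc_lo.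
  - by apply: emeasurable_funD => //; apply: emeasurable_sum.
rewrite ge0_integralD //; last 2 first.
- by move=> y _; apply: sume_ge0.
- exact: emeasurable_sum.
rewrite integral_cst // mul1e.
rewrite [X in (X + _)%E]probability_setT ge0_integral_sum //.
rewrite EFinD leeD2l //.
apply: (@le_trans _ _ (\sum_(k < L.+1) (4 * C)%:E)%E).
  apply: lee_sum => k _; apply: le_trans (integral_tail _ _) _.
  - by rewrite exprn_ge0.
  - by rewrite exprn_gt0.
  rewrite lee_fin le_eqVlt; apply/orP; left; apply/eqP.
  have k2 : (2 ^+ k : R) != 0 by rewrite expf_neq0.
  have -> : 4 ^+ k.+1 = 4 * (2 ^+ k) ^+ 2 :> R.
    by rewrite exprS -exprM mulnC exprM -[2 ^+ 2]natrX.
  by field; rewrite k2.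
rewrite sumEFin lee_fin sumr_const card_ord -[leLHS]mulr_natr ler_wpM2l ?mulr_ge0 //.
by case/andP: LM => + _; rewrite -[L.+1%:R]natr1 lerD2r.
Qed.

End tails.

(** * Quadratic tail and nonzero first moment of a power law *)

Section power_law.
Context {R : realType} (D : probability (measurableTypeR R) R) (p : R).
Hypotheses (hp : 2 <= p) (hD : symmetric_power_law D p).
Local Notation RT := (measurableTypeR R).

Lemma cdf_tail (x : R) : (D [set y : RT | (x < y)%R])%E = (1 - cdf_of D x)%:E.
Proof.
have -> : [set y : RT | x < y] = ~` [set y : RT | y <= x].
  by apply/seteqP; split=> y /=; rewrite ltNge => /negP.
have mle : measurable [set y : RT | y <= x].
  by have := measurable_itv `]-oo, x]; rewrite set_itvNyc.
rewrite probability_setC // /cdf_of EFinB fineK //.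
exact: fin_num_measure.
Qed.

(** Eventually the ratio in the definition lies between [1/2] and 2. The lower side keeps the tail
    positive, which later makes the first moment nonzero; the upper side is weakened by
    [x^(-p) <= x^(-2)] for [x >= 1]. *)
Lemma power_law_near :
  exists2 c : R, 0 < c & exists2 x0 : R, 1 <= x0 &
    forall x, x0 <= x -> 0 < 1 - cdf_of D x <= c / x ^+ 2.
Proof.
case: hD => _ [c c0 cv]; exists (2 * c); first by rewrite mulr_gt0.
have : \forall x \near +oo, 2^-1 < (1 - cdf_of D x) / (c * x `^ (- p)) < 2.
  near=> x; apply/andP; split; near: x.
    by apply: cvgr_gt cv _ _; rewrite invf_lt1 // ltr1n.
  by apply: cvgr_lt cv _ _; rewrite ltr1n.
case=> x1 [_ H]; exists (Num.max 1 (x1 + 1)); first by rewrite le_max lexx.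
move=> x; rewrite ge_max => /andP[x1le xle].
have x0 : 0 < x by apply: lt_le_trans x1le.
have /H/andP[h1 h2] : x1 < x by apply: lt_le_trans xle; rewrite ltrDl.
have q0 : 0 < c * x `^ (- p) by rewrite mulr_gt0 // powR_gt0.
move: h1 h2; rewrite ltr_pdivlMr // ltr_pdivrMr // => h1 h2; apply/andP; split.
  by apply: lt_trans h1; rewrite mulr_gt0.
apply: le_trans (ltW h2) _; rewrite -mulrA ler_wpM2l // ler_wpM2l ?(ltW c0) //.
have -> : (x ^+ 2)^-1 = x `^ (- 2%:R) by rewrite powRN powR_mulrn // ltW.
by rewrite ler_powR // lerN2.
Unshelve. all: end_near.
Qed.

Lemma power_law_tail : exists2 C : R, 0 < C &
  forall t : R, 0 < t -> (D (abs_gt t) <= (C / t ^+ 2)%:E)%E.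
Proof.
have [c c0 [x0 x01 H]] := power_law_near.
have x00 : 0 < x0 by apply: lt_le_trans x01.
(* The term [2 * c] serves [t >= x0], where symmetry doubles the one-sided tail; [x0 ^+ 2] serves
   [t < x0], where it makes the bound at least 1. *)
exists (2 * c + x0 ^+ 2); first by rewrite addr_gt0 ?mulr_gt0 ?exprn_gt0.
move=> t t0; have [tx|xt] := ltP t x0.
  apply: (@le_trans _ _ 1%E); first by apply: probability_le1; exact: measurable_tail.
  rewrite lee_fin ler_pdivlMr ?exprn_gt0 // mul1r.
  apply: (@le_trans _ _ (x0 ^+ 2)); last by rewrite lerDr mulr_ge0 // ltW.
  by rewrite ler_pXn2r ?nnegrE ?ltW.
have mgt : measurable [set y : RT | t < y].
  by have := measurable_itv `]t, +oo[; rewrite set_itvoy.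
have -> : abs_gt t = [set y : RT | t < y] `|` [set y : RT | t < - y].
  apply/seteqP; split=> y; rewrite /abs_gt /= lter_normr.
    by case/orP; [left|right].
  by case=> ->; rewrite ?orbT.
have mgtN : measurable [set y : RT | t < - y].
  have : measurable_fun [set: RT] (fun y : R => - y) by exact: measurable_funN.
  by move=> /(_ measurableT _ mgt); rewrite setTI.
apply: le_trans (measureU2 _ mgt mgtN) _.
have eN : D [set y : RT | t < - y] = D [set y : RT | t < y].
  by rewrite -[RHS](hD.1).
rewrite [X in (_ + X <= _)%E]eN [X in (X + _ <= _)%E]cdf_tail.
rewrite [X in (_ + X <= _)%E]cdf_tail -EFinD lee_fin.
have /andP[_] := H t xt => h; rewrite mulrDl -mulrA.
have : 0 <= x0 ^+ 2 / t ^+ 2 by rewrite divr_ge0 // exprn_ge0 // ltW.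
lra.
Qed.

Lemma power_law_abs_gt0 : (0 < \int[D]_y (`|y|)%:E)%E.
Proof.
have [c c0 [x0 x01 /(_ _ (lexx _))/andP[H _]]] := power_law_near.
have x00 : 0 < x0 by apply: lt_le_trans x01.
have mgt : measurable [set y : RT | x0 < y].
  by have := measurable_itv `]x0, +oo[; rewrite set_itvoy.
apply: (@lt_le_trans _ _ (\int[D]_y (x0%:E * (\1_[set y : RT | (x0 < y)%R] y)%:E))%E).
  rewrite ge0_integralZl_EFin //; last 2 first.
  - by apply/measurable_EFinP; apply: measurable_indic.
  - exact: ltW.
  rewrite integral_indic // setIT.
  by rewrite [X in (_ * X)%E]cdf_tail -EFinM lte_fin mulr_gt0.
apply: ge0_le_integral => //.
- by move=> y _; rewrite -EFinM lee_fin mulr_ge0 // ltW.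
- by apply/measurable_EFinP; apply: measurable_funM => //; apply: measurable_indic.
- by apply/measurable_EFinP; exact: measurable_abs.
move=> y _; rewrite -EFinM lee_fin indicE.
have [|_] := boolP (y \in _); last by rewrite mulr0.
by rewrite inE mulr1 => /= /ltW/le_trans; apply; exact: ler_norm.
Qed.

End power_law.

(** * Symmetrized row sums *)

Section row_sums.
Context {R : realType} {I J : finType}.
Local Notation RT := (measurableTypeR R).
Implicit Types (x : J -> R) (z : I * J -> R).

Definition rowsum x z : R := \sum_i `|\sum_j z (i, j) * x j|.

Lemma rowsum_ge0 x z : 0 <= rowsum x z.
Proof. by apply: sumr_ge0. Qed.

Lemma measurable_rowsum (d : measure_display) (S : measurableType d)
    (Z : I * J -> S -> R) x : (forall k, measurable_fun setT (Z k)) ->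
  measurable_fun setT (fun s => rowsum x (fun k => Z k s)).
Proof.
move=> mZ; apply: measurable_sum => i.
apply: (@measurableT_comp _ _ _ _ _ _ (fun y : R => `|y|)) => //.
by apply: measurable_sum => j; apply: measurable_funM.
Qed.

Variable u : nat -> J -> R.
Hypothesis u1 : forall k, \sum_j u k j ^+ 2 <= 1.
Implicit Types (F : seq nat) (s : {ffun I -> bool}) (zz : I * J + I * J -> R).

(* The two copies of the index set stand for a sample and its ghost. *)
Definition maxdiff F zz : R :=
  \big[Num.max/0]_(k <- F) `|rowsum (u k) (zz \o inl) - rowsum (u k) (zz \o inr)|.

Lemma maxdiff_ge0 F zz : 0 <= maxdiff F zz.
Proof. exact: bigmax_ge_id. Qed.

Lemma measurable_maxdiff (d : measure_display) (S : measurableType d)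
    (Z : I * J + I * J -> S -> R) F : (forall k, measurable_fun setT (Z k)) ->
  measurable_fun setT (fun t => maxdiff F (fun k => Z k t)).
Proof.
move=> mZ; elim: F => [|k F IHF].
  by under eq_fun do rewrite /maxdiff big_nil; exact: measurable_cst.
under eq_fun do rewrite /maxdiff big_cons.
apply: measurable_maxr => //.
apply: (@measurableT_comp _ _ _ _ _ _ (fun y : R => `|y|)) => //.
by apply: measurable_funB; apply: measurable_rowsum.
Qed.

(** Whole rows are exchanged with their ghosts. This permutes an i.i.d. family, so it preserves the
    joint law, and on row differences it acts as multiplication by the sign. *)
Definition swap s (k : I * J + I * J) : I * J + I * J :=
  match k with
  | inl ij => if s ij.1 then inr ij else inl ij
  | inr ij => if s ij.1 then inl ij else inr ij
  end.

Lemma swapK s : involutive (swap s).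
Proof. by case=> ij /=; case E: (s ij.1) => /=; rewrite E. Qed.

Lemma maxdiff_swap F zz s : maxdiff F (zz \o swap s) =
  \big[Num.max/0]_(k <- F) `|\sum_i sg s i *
    (`|\sum_j zz (inl (i, j)) * u k j| - `|\sum_j zz (inr (i, j)) * u k j|)|.
Proof.
apply: eq_bigr => k _; congr `|_|; rewrite /rowsum -sumrB; apply: eq_bigr => i _.
by rewrite /sg /=; case: (s i); rewrite /= ?expr1 ?expr0 ?mul1r ?mulN1r ?opprB.
Qed.

(** One-sided, without an outer absolute value, because contraction applies to signed sums; the
    opposite sign pattern recovers the other side. *)
Definition radmax F s z : R :=
  \big[Num.max/0]_(k <- F) \sum_i sg s i * `|\sum_j z (i, j) * u k j|.

Definition sneg s := [ffun i => ~~ s i].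

Lemma snegK : involutive sneg.
Proof. by move=> s; apply/ffunP => i; rewrite !ffunE negbK. Qed.

Lemma sg_sneg s i : sg (sneg s) i = - sg s i :> R.
Proof. by rewrite /sg ffunE signrN. Qed.

Lemma maxdiff_swap_le F zz s : maxdiff F (zz \o swap s) <=
  (radmax F s (zz \o inl) + radmax F (sneg s) (zz \o inr)) +
  (radmax F (sneg s) (zz \o inl) + radmax F s (zz \o inr)).
Proof.
have r0 s' z' : 0 <= radmax F s' z' by exact: bigmax_ge_id.
rewrite maxdiff_swap; elim: F r0 => [|k F IHF] r0.
  by rewrite big_nil !addr_ge0.
have rle s' z' : \sum_i sg s' i * `|\sum_j z' (i, j) * u k j| <= radmax (k :: F) s' z'.
  by rewrite /radmax big_cons le_max lexx.
have rF s' z' : radmax F s' z' <= radmax (k :: F) s' z'.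
  by rewrite /radmax big_cons le_max lexx orbT.
rewrite big_cons ge_max; apply/andP; split; last first.
  apply: le_trans (IHF _) _; first by move=> *; exact: bigmax_ge_id.
  by rewrite !lerD.
have sN z' : \sum_i sg (sneg s) i * `|\sum_j z' (i, j) * u k j| =
    - \sum_i sg s i * `|\sum_j z' (i, j) * u k j|.
  by rewrite -sumrN; apply: eq_bigr => i _; rewrite sg_sneg mulNr.
under eq_bigr do rewrite mulrBr.
rewrite sumrB.
have := rle s (zz \o inl); have := rle (sneg s) (zz \o inl).
have := rle s (zz \o inr); have := rle (sneg s) (zz \o inr).
have := r0 s (zz \o inl); have := r0 (sneg s) (zz \o inl).
have := r0 s (zz \o inr); have := r0 (sneg s) (zz \o inr).
rewrite !sN /= ler_norml; lra.
Qed.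

Definition radbound (q M : R) z : R :=
  q / 2 + \sum_i \sum_j
    (trunc_lo M (z (i, j)) ^+ 2 / (2 * q) + `|trunc_hi M (z (i, j))|).

(** The default 0 of the maximum is itself a value of [f], so a maximizer exists even for empty [F].
    It supplies the choice of points that contraction expects. *)
Lemma bigmax_attained (V : Type) (Q : V -> Prop) (f : V -> R) (v0 : V)
    (w : nat -> V) F : Q v0 -> f v0 = 0 -> (forall k, Q (w k)) ->
  exists2 v, Q v & \big[Num.max/0]_(k <- F) f (w k) = f v.
Proof.
move=> Q0 f0 Qw; elim: F => [|k F [v Qv e]].
  by exists v0; rewrite // big_nil.
rewrite big_cons e; case: (leP (f (w k)) (f v)) => _.
  by exists v.
by exists (w k).
Qed.

Lemma sum_radmax F q M z : 0 < q ->
  \sum_s radmax F s z <= #|{: {ffun I -> bool}}|%:R * radbound q M z.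
Proof.
move=> q0; pose f s (v : J -> R) := \sum_i sg s i * `|\sum_j z (i, j) * v j|.
have /choice[y yP] : forall s, exists v : J -> R,
    \sum_j v j ^+ 2 <= 1 /\ radmax F s z = f s v.
  move=> s.
  have [||v Qv e] := @bigmax_attained _ (fun v => \sum_j v j ^+ 2 <= 1) (f s)
    (fun=> 0) u F _ _ u1.
  - by rewrite big1 // => j _; rewrite expr0n.
  - rewrite /f big1 // => i _; rewrite big1 ?normr0 ?mulr0 // => j _.
    by rewrite mulr0.
  by exists v.
rewrite (eq_bigr (fun s => f s (y s))); last by move=> s _; case: (yP s).
have := @rademacher_bound R I J (fun i j => trunc_lo M (z (i, j)))
  (fun i j => trunc_hi M (z (i, j))) q y q0 (fun s => (yP s).1).
apply: le_trans; rewrite le_eqVlt; apply/orP; left; apply/eqP.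
apply: eq_bigr => s _; apply: eq_bigr => i _; congr (_ * `|_|).
by apply: eq_bigr => j _; rewrite trunc_add.
Qed.

Lemma sum_maxdiff_swap F q M zz : 0 < q ->
  \sum_s maxdiff F (zz \o swap s) <= #|{: {ffun I -> bool}}|%:R *
    (2 * (radbound q M (zz \o inl) + radbound q M (zz \o inr))).
Proof.
move=> q0.
have neg z : \sum_s radmax F (sneg s) z = \sum_s radmax F s z.
  by rewrite [RHS](reindex_inj (inv_inj snegK)).
apply: (le_trans (ler_sum _ (fun s _ => maxdiff_swap_le F zz s))).
rewrite !big_split /= !neg.
have := sum_radmax F M (zz \o inl) q0; have := sum_radmax F M (zz \o inr) q0.
set N : R := #|_|%:R; lra.
Qed.

End row_sums.

(** * The mean of a row sum *)

Lemma sume_const (R : realType) (K : finType) (c : \bar R) :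
  (\sum_(k in K) c = #|K|%:R%:E * c)%E.
Proof.
rewrite (eq_bigr (fun=> 1%E * c)%E) => [|k _]; last by rewrite mul1e.
by rewrite -ge0_sume_distrl ?sumEFin ?sumr_const // => k _; rewrite lee_fin.
Qed.

(** One entry is a family indexed by [unit], with the same law as the identity on [D]. *)
Lemma iid_marginal (R : realType) (D : probability (measurableTypeR R) R)
    (disp : measure_display) (T : measurableType disp) (P : probability T R)
    (K : finType) (X : K -> T -> measurableTypeR R)
    (f : measurableTypeR R -> \bar R) (k : K) : iid_family D P X ->
  measurable_fun setT f -> (forall y, 0 <= f y)%E ->
  (\int[P]_t f (X k t) = \int[D]_y f y)%E.
Proof.
move=> iidX mf f0; set RT := measurableTypeR R.
have iid1 : iid_family D P (fun _ : unit => X k).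
  by apply: (@iid_inj R D disp T P _ _ X (fun=> k)) => // -[] [].
have iid2 : iid_family D D (fun _ : unit => (id : RT -> RT)).
  split=> [_|B mB]; first exact: measurable_id.
  have -> : \bigcap_k ((id : RT -> RT) @^-1` B k) = B tt.
    by apply/seteqP; split=> [y /(_ tt I)//|y By []].
  by rewrite (big_pred1 tt) ?fineK ?fin_num_measure // => -[].
rewrite (iid_integral (h := fun z => f (z tt)) iid1 iid2) //.
exact: measurableT_comp (measurable_fam tt).
Qed.

Section concentration.
Context {R : realType} (D : probability (measurableTypeR R) R).
Context {I J : finType} (disp : measure_display) (T : measurableType disp).
Variables (P : probability T R) (X : I * J -> T -> measurableTypeR R).
Hypothesis iidX : iid_family D P X.
Local Notation RT := (measurableTypeR R).

Lemma integral_rowsum_flip (x : J -> R) (s : {ffun J -> bool}) :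
  symmetric_distribution D ->
  (\int[P]_t (rowsum x (fun k => X k t))%:E =
   \int[P]_t (rowsum x (fun k => sg s k.2 * X k t))%:E)%E.
Proof.
move=> sD; have iidF := iid_flip (fun k : I * J => s k.2) sD iidX.
rewrite (iid_integral (h := fun z => (rowsum x z)%:E) iidX iidF) //.
- apply/measurable_EFinP; apply: (measurable_rowsum (Z := fun k w => fam w k)).
  exact: measurable_fam.
- by move=> z; rewrite lee_fin rowsum_ge0.
Qed.

(** Symmetry allows averaging over signs attached to the columns. For fixed entries, Khinchine then
    bounds each row below by half of [\sum_j x_j^2 |X_ij|], whose mean is that of [|y|] because [x]
    is a unit vector. *)
Lemma integral_rowsum_ge (x : J -> R) : symmetric_distribution D ->
  \sum_j x j ^+ 2 = 1 ->
  ((#|I|%:R / 2)%:E * \int[D]_y (`|y|)%:E <=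
    \int[P]_t (rowsum x (fun k => X k t))%:E)%E.
Proof.
move=> sD x1; pose N : R := #|{: {ffun J -> bool}}|%:R.
have N0 : 0 < N by rewrite ltr0n; apply/card_gt0P; exists [ffun=> true].
have mX k : measurable_fun setT (X k) := iidX.1 k.
have m_abs : measurable_fun [set: RT] (fun y => (`|y : R|)%:E).
  by apply/measurable_EFinP; exact: measurable_abs.
have pt t : N / 2 * \sum_i \sum_j x j ^+ 2 * `|X (i, j) t| <=
    \sum_(s : {ffun J -> bool}) rowsum x (fun k => sg s k.2 * X k t).
  rewrite [leRHS]exchange_big mulr_sumr /=; apply: ler_sum => i _.
  (* Giving [x j] the sign of the entry makes [X (i, j) t * x j * w j] equal to [x j ^+ 2] times the
     absolute value of the entry. *)
  pose w j := if 0 <= X (i, j) t then x j else - x j.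
  have w1 : \sum_j w j ^+ 2 <= 1.
    rewrite -x1 le_eqVlt; apply/orP; left; apply/eqP; apply: eq_bigr => j _.
    by rewrite /w; case: ifP => _ //; rewrite sqrrN.
  have := khinchine (fun j => X (i, j) t * x j) w1.
  rewrite -/N => k.
  have -> : N / 2 * \sum_j x j ^+ 2 * `|X (i, j) t| =
      2^-1 * (N * \sum_j X (i, j) t * x j * w j).
    rewrite [RHS]mulrA [2^-1 * _]mulrC; congr (_ * _); apply: eq_bigr => j _.
    rewrite /w; case: leP => X0; first by rewrite ger0_norm //; ring.
    by rewrite ltr0_norm //; ring.
  rewrite ler_pdivrMl //; apply: le_trans k _; rewrite ler_wpM2l //.
  rewrite le_eqVlt; apply/orP; left; apply/eqP; apply: eq_bigr => s _.
  by congr `|_|; apply: eq_bigr => j _; rewrite mulrA.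
have int_lhs : (\int[P]_t (N / 2 * \sum_i \sum_j x j ^+ 2 * `|X (i, j) t|)%:E =
    N%:E * ((#|I|%:R / 2)%:E * \int[D]_y (`|y|)%:E))%E.
  transitivity (\int[P]_t ((N / 2)%:E *
      \sum_i \sum_j (x j ^+ 2)%:E * (`|X (i, j) t|)%:E))%E.
    apply: eq_integral => t _; rewrite EFinM -sumEFin; congr (_ * _)%E.
    by apply: eq_bigr => i _; rewrite -sumEFin.
  have mi i : measurable_fun setT
      (fun t => \sum_j (x j ^+ 2)%:E * (`|X (i, j) t|)%:E)%E.
    apply: emeasurable_sum => j; apply: emeasurable_funM => //.
    exact: measurableT_comp m_abs (mX _).
  have i0 i t : (0 <= \sum_j (x j ^+ 2)%:E * (`|X (i, j) t|)%:E)%E.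
    by apply: sume_ge0 => j _; rewrite mule_ge0 // lee_fin sqr_ge0.
  rewrite ge0_integralZl_EFin //; last 3 first.
  - by move=> t _; apply: sume_ge0.
  - exact: emeasurable_sum.
  - by rewrite divr_ge0 // ltW.
  rewrite ge0_integral_sum //.
  rewrite (eq_bigr (fun=> \int[D]_y (`|y|)%:E)%E) => [|i _].
    rewrite sume_const muleA muleA -!EFinM; congr (_%:E * _)%E.
    by field.
  rewrite ge0_integral_sum //; last 2 first.
  - move=> j; apply: emeasurable_funM => //.
    exact: measurableT_comp m_abs (mX _).
  - by move=> j t _; rewrite mule_ge0 // lee_fin sqr_ge0.
  rewrite (eq_bigr (fun j => (x j ^+ 2)%:E * \int[D]_y (`|y|)%:E)%E) => [|j _].
    rewrite -ge0_sume_distrl; last by move=> j _; rewrite lee_fin sqr_ge0.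
    by rewrite sumEFin x1 mul1e.
  rewrite ge0_integralZl_EFin //; last 2 first.
  - exact: measurableT_comp m_abs (mX _).
  - by rewrite sqr_ge0.
  by rewrite (iid_marginal (f := fun y => (`|y : R|)%:E) _ iidX).
have int_rhs : (\int[P]_t (\sum_(s : {ffun J -> bool})
      rowsum x (fun k => sg s k.2 * X k t))%:E =
    N%:E * \int[P]_t (rowsum x (fun k => X k t))%:E)%E.
  transitivity (\int[P]_t (\sum_(s : {ffun J -> bool})
      (rowsum x (fun k => sg s k.2 * X k t))%:E))%E.
    by apply: eq_integral => t _; rewrite sumEFin.
  rewrite ge0_integral_sum //.
  - rewrite (eq_bigr (fun=> \int[P]_t (rowsum x (fun k => X k t))%:E)%E).
      by rewrite sume_const.
    by move=> s _; rewrite -integral_rowsum_flip.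
  - move=> s; apply/measurable_EFinP.
    apply: (measurable_rowsum (Z := fun k t => sg s k.2 * X k t)) => k.
    by apply: measurable_funM => //; exact: mX.
  - by move=> s t _; rewrite lee_fin rowsum_ge0.
rewrite -(@lee_pmul2l _ N%:E) ?lte_fin // -int_lhs -int_rhs.
apply: ge0_le_integral => //.
- move=> t _; rewrite lee_fin mulr_ge0 ?divr_ge0 ?(ltW N0) //.
  by apply: sumr_ge0 => i _; apply: sumr_ge0 => j _; rewrite mulr_ge0 // sqr_ge0.
- apply/measurable_EFinP; apply: measurable_funM => //.
  apply: measurable_sum => i; apply: measurable_sum => j.
  apply: measurable_funM => //.
  exact: measurableT_comp measurable_abs (mX _).
- apply/measurable_EFinP; apply: measurable_sum => s.
  apply: (measurable_rowsum (Z := fun k t => sg s k.2 * X k t)) => k.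
  by apply: measurable_funM => //; exact: mX.
- by move=> t _; rewrite lee_fin pt.
Qed.

End concentration.

(** * Deviations from the mean *)

Section ghost_sample.
Context {R : realType} (D : probability (measurableTypeR R) R).
Context {I J : finType}.
Local Notation RT := (measurableTypeR R).
Variables (q M v1 v2 : R).
Hypotheses (q0 : 0 < q).
Hypothesis lo_le : (\int[D]_y (trunc_lo M y ^+ 2)%:E <= v2%:E)%E.
Hypothesis hi_le : (\int[D]_y (`|trunc_hi M y|)%:E <= v1%:E)%E.

(** Bounds the mean of [radbound] when [v2] bounds the second moment of the small part of an entry
    and [v1] the first moment of its large part. *)
Definition rad_mean : R := q / 2 + #|I|%:R * (#|J|%:R * (v2 / (2 * q) + v1)).

Lemma radbound_ge0 (z : I * J -> R) : 0 <= radbound q M z.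
Proof.
rewrite addr_ge0 ?divr_ge0 ?(ltW q0) // sumr_ge0 // => i _.
rewrite sumr_ge0 // => j _; rewrite addr_ge0 // divr_ge0 ?sqr_ge0 //.
by rewrite mulr_ge0 // ltW.
Qed.

Lemma measurable_radbound (disp : measure_display) (S : measurableType disp)
    (Z : I * J -> S -> RT) : (forall k, measurable_fun setT (Z k)) ->
  measurable_fun setT (fun t => radbound q M (fun k => Z k t)).
Proof.
move=> mZ; apply: measurable_funD => //; apply: measurable_sum => i.
apply: measurable_sum => j; apply: measurable_funD.
  apply: measurable_funM => //; apply: measurable_funX.
  exact: measurableT_comp (measurable_trunc_lo M) (mZ _).
apply: (measurableT_comp (f := fun y : R => `|y|)) => //.
exact: measurableT_comp (measurable_trunc_hi M) (mZ _).
Qed.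

Lemma integral_radbound (disp : measure_display) (S : measurableType disp)
    (Q : probability S R) (Z : I * J -> S -> RT) : iid_family D Q Z ->
  (\int[Q]_t (radbound q M (fun k => Z k t))%:E <= rad_mean%:E)%E.
Proof.
move=> iidZ; have mZ := iidZ.1.
pose lo (y : RT) : \bar R := (trunc_lo M y ^+ 2)%:E.
pose hi (y : RT) : \bar R := (`|trunc_hi M y|)%:E.
have mlo : measurable_fun setT lo.
  by apply/measurable_EFinP; apply: measurable_funX; exact: measurable_trunc_lo.
have mhi : measurable_fun setT hi.
  apply/measurable_EFinP; apply: (measurableT_comp (f := fun y : R => `|y|)) => //.
  exact: measurable_trunc_hi.
have lo0 y : (0 <= lo y)%E by rewrite lee_fin sqr_ge0.
have hi0 y : (0 <= hi y)%E by rewrite lee_fin.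
have c0 : 0 <= (2 * q)^-1 by rewrite invr_ge0 mulr_ge0 // ltW.
have mloZ k : measurable_fun setT (fun t => ((2 * q)^-1)%:E * lo (Z k t))%E.
  by apply: emeasurable_funM => //; exact: measurableT_comp mlo (mZ k).
have mhiZ k : measurable_fun setT (fun t => hi (Z k t)).
  exact: measurableT_comp mhi (mZ k).
have loZ0 k t : (0 <= ((2 * q)^-1)%:E * lo (Z k t))%E by rewrite mule_ge0.
have entry k : (\int[Q]_t (((2 * q)^-1)%:E * lo (Z k t) + hi (Z k t)) <=
    (v2 / (2 * q) + v1)%:E)%E.
  rewrite ge0_integralD // ge0_integralZl_EFin //; last first.
    exact: measurableT_comp mlo (mZ k).
  rewrite (iid_marginal k iidZ mlo lo0) (iid_marginal k iidZ mhi hi0).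
  rewrite EFinD [v2 / _]mulrC EFinM; apply: leeD => //.
  by apply: lee_wpmul2l; rewrite ?lee_fin.
have -> : (\int[Q]_t (radbound q M (fun k => Z k t))%:E =
    \int[Q]_t ((q / 2)%:E + \sum_i \sum_j
      (((2 * q)^-1)%:E * lo (Z (i, j) t) + hi (Z (i, j) t))))%E.
  apply: eq_integral => t _; rewrite /radbound EFinD -sumEFin; congr (_ + _)%E.
  apply: eq_bigr => i _; rewrite -sumEFin; apply: eq_bigr => j _.
  by rewrite EFinD [_ / (2 * q)]mulrC EFinM.
have mij i j : measurable_fun setT
    (fun t => ((2 * q)^-1)%:E * lo (Z (i, j) t) + hi (Z (i, j) t))%E.
  exact: emeasurable_funD.
have ij0 i j t : (0 <= ((2 * q)^-1)%:E * lo (Z (i, j) t) + hi (Z (i, j) t))%E.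
  exact: adde_ge0.
rewrite ge0_integralD //; last 3 first.
- by move=> t _; rewrite lee_fin divr_ge0 // ltW.
- by move=> t _; apply: sume_ge0 => i _; apply: sume_ge0 => j _; exact: ij0.
- by apply: emeasurable_sum => i; apply: emeasurable_sum => j; exact: mij.
rewrite integral_cst // [X in (_ * X)%E]probability_setT mule1 /rad_mean EFinD.
apply: leeD2l; rewrite ge0_integral_sum //; last 2 first.
- by move=> i; apply: emeasurable_sum => j; exact: mij.
- by move=> i t _; apply: sume_ge0 => j _; exact: ij0.
rewrite EFinM -sume_const; apply: lee_sum => i _.
rewrite ge0_integral_sum // EFinM -sume_const; apply: lee_sum => j _.
exact: entry.
Qed.

Variables (disp : measure_display) (T : measurableType disp).
Variables (P : probability T R) (X : I * J -> T -> RT).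
Hypothesis iidX : iid_family D P X.
Variable u : nat -> J -> R.
Hypothesis u1 : forall k, \sum_j u k j ^+ 2 <= 1.

Definition ghost (t : T * T) (k : I * J + I * J) : RT :=
  match k with inl i => X i t.1 | inr j => X j t.2 end.

Let iidG : iid_family D (P \x P)%E (fun k t => ghost t k).
Proof. exact: iid_prod. Qed.

(** All swapped versions of [maxdiff] have the same integral, so it equals the integral of their
    average over [s], which is bounded pointwise. The factor 4 is 2 from the two signs times 2 from
    sample and ghost. *)
Lemma integral_maxdiff (F : seq nat) :
  (\int[(P \x P)%E]_t (maxdiff u F (ghost t))%:E <= (4 * rad_mean)%:E)%E.
Proof.
have mG := iidG.1.
pose N : R := #|{: {ffun I -> bool}}|%:R.
have N0 : 0 < N by rewrite ltr0n; apply/card_gt0P; exists [ffun=> true].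
have msw s : measurable_fun setT (fun t => (maxdiff u F (ghost t \o swap s))%:E).
  apply/measurable_EFinP.
  by apply: (measurable_maxdiff u (Z := fun k t => ghost t (swap s k))) => k;
    exact: mG.
have eqsw s : (\int[(P \x P)%E]_t (maxdiff u F (ghost t))%:E =
    \int[(P \x P)%E]_t (maxdiff u F (ghost t \o swap s))%:E)%E.
  have iidS := iid_inj (inv_inj (@swapK I J s)) iidG.
  rewrite (iid_integral (h := fun z => (maxdiff u F z)%:E) iidG iidS) //.
  - apply/measurable_EFinP; apply: (measurable_maxdiff u (Z := fun k w => fam w k)).
    exact: measurable_fam.
  - by move=> z; rewrite lee_fin maxdiff_ge0.
rewrite -(@lee_pmul2l _ N%:E) ?lte_fin //.
rewrite -(sume_const {ffun I -> bool}).
rewrite (eq_bigr _ (fun s _ => eqsw s)) -ge0_integral_sum //; last first.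
  by move=> s t _; rewrite lee_fin maxdiff_ge0.
have iidl : iid_family D (P \x P)%E (fun k t => ghost t (inl k)).
  by apply: (iid_inj _ iidG) => k l [].
have iidr : iid_family D (P \x P)%E (fun k t => ghost t (inr k)).
  by apply: (iid_inj _ iidG) => k l [].
have ml := measurable_radbound iidl.1; have mr := measurable_radbound iidr.1.
apply: (@le_trans _ _ (\int[(P \x P)%E]_t ((N * 2)%:E *
  ((radbound q M (fun k => ghost t (inl k)))%:E +
   (radbound q M (fun k => ghost t (inr k)))%:E)))%E).
  apply: ge0_le_integral => //.
  - by move=> t _; apply: sume_ge0 => s _; rewrite lee_fin maxdiff_ge0.
  - exact: emeasurable_sum.
  - by apply: emeasurable_funM => //; apply: emeasurable_funD; exact/measurable_EFinP.
  - move=> t _; rewrite sumEFin -EFinD -EFinM lee_fin -mulrA.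
    have h := sum_maxdiff_swap u1 F M (ghost t) q0.
    exact: h.
rewrite ge0_integralZl_EFin //; last 3 first.
- by move=> t _; rewrite adde_ge0 // lee_fin radbound_ge0.
- by apply: emeasurable_funD; exact/measurable_EFinP.
- by rewrite mulr_ge0 // ltW.
rewrite ge0_integralD //; last 4 first.
- by move=> t _; rewrite lee_fin radbound_ge0.
- exact/measurable_EFinP.
- by move=> t _; rewrite lee_fin radbound_ge0.
- exact/measurable_EFinP.
rewrite (_ : 4 * rad_mean = 2 * (rad_mean + rad_mean)); last by ring.
rewrite EFinM -muleA (EFinM 2) (EFinD rad_mean); apply: lee_wpmul2l.
  by rewrite lee_fin ltW.
apply: lee_wpmul2l; first by rewrite lee_fin.
by apply: leeD; exact: integral_radbound.
Qed.

Hypothesis fin_mean : forall k,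
  (\int[P]_t (rowsum (u k) (fun ij => X ij t))%:E \is a fin_num)%E.

Definition deviation (k : nat) (t : T) : R :=
  `|rowsum (u k) (fun ij => X ij t) -
    fine (\int[P]_t (rowsum (u k) (fun ij => X ij t))%:E)%E|.

Lemma measurable_deviation k : measurable_fun setT (deviation k).
Proof.
apply: (measurableT_comp (f := fun y : R => `|y|)) => //.
by apply: measurable_funB => //; apply: measurable_rowsum; exact: iidX.1.
Qed.

Lemma measurable_deviation_gt (l : R) k :
  measurable [set t | l < deviation k t].
Proof.
rewrite -preimage_itvoy -[X in measurable X]setTI.
exact: (measurable_deviation k measurableT (measurable_itv _)).
Qed.

(* Averaging over the ghost coordinate replaces the ghost row sums by their
   mean. *)
Lemma deviation_le (F : seq nat) k t : k \in F ->
  ((deviation k t)%:E <= \int[P]_t' (maxdiff u F (ghost (t, t')))%:E)%E.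
Proof.
move=> kF; set G := (X in (_ <= X)%E).
pose r t := rowsum (u k) (fun ij => X ij t).
have mr : measurable_fun setT r by apply: measurable_rowsum; exact: iidX.1.
have mmd : measurable_fun setT (fun t' => maxdiff u F (ghost (t, t'))).
  apply: (measurable_maxdiff u (Z := fun k t' => ghost (t, t') k)) => -[ij|ij] /=.
    exact: measurable_cst.
  exact: iidX.1.
have rle t' : `|r t - r t'| <= maxdiff u F (ghost (t, t')).
  have := @le_bigmax_seq _ R nat F 0 k predT (fun k =>
    `|rowsum (u k) (ghost (t, t') \o inl) - rowsum (u k) (ghost (t, t') \o inr)|)
    kF isT.
  exact.
have cstE (c : R) : (\int[P]_t' c%:E = c%:E)%E.
  by rewrite integral_cst // [X in (_ * X)%E]probability_setT mule1.
have m_fin := fin_mean k; rewrite -/r in m_fin.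
have G0 : (0 <= G)%E by apply: integral_ge0 => t' _; rewrite lee_fin maxdiff_ge0.
have up : ((r t)%:E <= \int[P]_t' (r t')%:E + G)%E.
  rewrite -cstE -ge0_integralD //; first last.
  - exact/measurable_EFinP.
  - by move=> t' _; rewrite lee_fin maxdiff_ge0.
  - exact/measurable_EFinP.
  - by move=> t' _; rewrite lee_fin rowsum_ge0.
  apply: ge0_le_integral => //.
  - by move=> t' _; rewrite lee_fin rowsum_ge0.
  - by apply: emeasurable_funD; exact/measurable_EFinP.
  - move=> t' _; rewrite -EFinD lee_fin -lerBlDl.
    by apply: le_trans (rle t'); exact: ler_norm.
have dn : (\int[P]_t' (r t')%:E <= (r t)%:E + G)%E.
  rewrite -[in leRHS]cstE -ge0_integralD //; first last.
  - exact/measurable_EFinP.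
  - by move=> t' _; rewrite lee_fin maxdiff_ge0.
  - by move=> t' _; rewrite lee_fin rowsum_ge0.
  apply: ge0_le_integral => //.
  - by move=> t' _; rewrite lee_fin rowsum_ge0.
  - exact/measurable_EFinP.
  - by apply: emeasurable_funD => //; exact/measurable_EFinP.
  - move=> t' _; rewrite -EFinD lee_fin -lerBlDl.
    by apply: le_trans (rle t'); rewrite distrC; exact: ler_norm.
rewrite /deviation -/(r t); move: up dn m_fin.
case: (\int[P]_t' _)%E => // m; case: G G0 => [g| |] //.
  rewrite !lee_fin => _ up dn _; rewrite ler_norml /=; apply/andP; split; lra.
by move=> *; rewrite leey.
Qed.

(** Markov's inequality for the partial integral [G], which dominates every deviation with index in
    [F] and whose mean is given by Tonelli. *)
Lemma deviation_finite (l : R) n : 0 < l ->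
  (P (\bigcup_(k in `I_n) [set t | (l < deviation k t)%R]) <=
    (4 * rad_mean / l)%:E)%E.
Proof.
move=> l0; pose F := iota 0 n.
pose G t := (\int[P]_t' (maxdiff u F (ghost (t, t')))%:E)%E.
have mMD : measurable_fun setT (fun t => (maxdiff u F (ghost t))%:E).
  apply/measurable_EFinP; apply: (measurable_maxdiff u (Z := fun k t => ghost t k)).
  exact: iidG.1.
have MD0 t : (0 <= (maxdiff u F (ghost t))%:E)%E by rewrite lee_fin maxdiff_ge0.
have mG : measurable_fun setT G.
  exact: (measurable_fun_fubini_tonelli_F _ mMD).
have G0 t : (0 <= G t)%E by apply: integral_ge0.
have GE : (\int[P]_t G t <= (4 * rad_mean)%:E)%E.
  by rewrite -[leLHS](fubini_tonelli1 _ mMD) //; exact: integral_maxdiff.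
have mk : (l%:E * P [set t | (l%:E <= `|G t|)%E] <= (4 * rad_mean)%:E)%E.
  apply: le_trans GE.
  have := @le_integral_comp_abse _ _ R P setT measurableT G l id (@measurable_id _ _ _)
    (fun r r0 => r0) (fun x y _ _ xy => xy) mG l0.
  rewrite setTI => /le_trans; apply.
  apply: ge0_le_integral => //; first exact: measurableT_comp.
  by move=> t _; rewrite gee0_abs.
have mS : measurable [set t | (l%:E <= `|G t|)%E].
  rewrite -[X in measurable X]setTI; apply: emeasurable_fun_c_infty => //.
  exact: measurableT_comp.
apply: (@le_trans _ _ (P [set t | (l%:E <= `|G t|)%E])).
  apply: le_measure; rewrite ?inE //.
    by apply: bigcup_measurable => k _; exact: measurable_deviation_gt.
  move=> t [k /= kn /ltW lk]; rewrite gee0_abs //.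
  apply: le_trans (deviation_le (k := k) _ _); first by rewrite lee_fin.
  by rewrite mem_iota add0n.
by rewrite [_ / l]mulrC EFinM lee_pdivlMl.
Qed.

(** The finite bound does not depend on [n], so continuity from below applies. *)
Lemma deviation_countable (l : R) : 0 < l ->
  (P (\bigcup_k [set t | (l < deviation k t)%R]) <= (4 * rad_mean / l)%:E)%E.
Proof.
move=> l0; pose U n := \bigcup_(k in `I_n) [set t | l < deviation k t].
have mU n : measurable (U n).
  by apply: bigcup_measurable => k _; exact: measurable_deviation_gt.
have UE : \bigcup_n U n = \bigcup_k [set t | l < deviation k t].
  apply/seteqP; split=> [t [n _ [k _ lk]]|t [k _ lk]]; first by exists k.
  by exists k.+1 => //; exists k => /=.
have : P \o U @ \oo --> P (\bigcup_n U n).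
  apply: nondecreasing_cvg_mu => //; first exact: bigcupT_measurable.
  move=> n m nm; apply/subsetPset; apply: bigcup_subset => k /= kn.
  exact: leq_trans kn nm.
rewrite UE => cv; rewrite -(cvg_lim _ cv) //; apply: lime_le.
  by apply/cvg_ex; eexists; exact: cv.
by apply: nearW => n /=; exact: deviation_finite.
Qed.

End ghost_sample.

(** * Concentration for power laws *)

Section row_means.
Context {R : realType} (D : probability (measurableTypeR R) R).
Local Notation RT := (measurableTypeR R).

Lemma integral_rowsumE (I J : finType) (disp : measure_display)
    (T : measurableType disp) (P : probability T R) (X : I * J -> T -> RT)
    (x : J -> R) : iid_family D P X ->
  (\int[P]_t (rowsum x (fun k => X k t))%:E =
   \sum_i \int[P]_t (`|\sum_j X (i, j) t * x j|)%:E)%E.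
Proof.
move=> iidX; rewrite -ge0_integral_sum //.
  by apply: eq_integral => t _; rewrite sumEFin.
move=> i; apply/measurable_EFinP.
apply: (measurableT_comp (f := fun y : R => `|y|)) => //.
by apply: measurable_sum => j; apply: measurable_funM => //; exact: iidX.1.
Qed.

(** All rows have the same mean, so both sides count it once per pair of rows. This is why rescaling
    by [n / r] matches the two means. *)
Lemma integral_rowsum_card (I1 I2 J : finType) (disp1 disp2 : measure_display)
    (T1 : measurableType disp1) (T2 : measurableType disp2)
    (P1 : probability T1 R) (P2 : probability T2 R)
    (X1 : I1 * J -> T1 -> RT) (X2 : I2 * J -> T2 -> RT) (x : J -> R) :
  iid_family D P1 X1 -> iid_family D P2 X2 ->
  (#|I2|%:R%:E * \int[P1]_t (rowsum x (fun k => X1 k t))%:E =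
   #|I1|%:R%:E * \int[P2]_t (rowsum x (fun k => X2 k t))%:E)%E.
Proof.
move=> iid1 iid2.
have row i1 i2 : (\int[P1]_t (`|\sum_j X1 (i1, j) t * x j|)%:E =
    \int[P2]_t (`|\sum_j X2 (i2, j) t * x j|)%:E)%E.
  have iidr1 : iid_family D P1 (fun j => X1 (i1, j)).
    by apply: (iid_inj _ iid1) => j k [].
  have iidr2 : iid_family D P2 (fun j => X2 (i2, j)).
    by apply: (iid_inj _ iid2) => j k [].
  apply: (iid_integral (h := fun z => (`|\sum_j z j * x j|)%:E) iidr1 iidr2) => //.
  apply/measurable_EFinP.
  apply: (measurableT_comp (f := fun y : R => `|y|)) => //.
  apply: measurable_sum => j; apply: measurable_funM => //.
  exact: measurable_fam.
rewrite (integral_rowsumE _ iid1) (integral_rowsumE _ iid2) -!sume_const.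
rewrite exchange_big /= [RHS]exchange_big /= [RHS]exchange_big /=.
by apply: eq_bigr => i1 _; apply: eq_bigr => i2 _; exact: row.
Qed.

Lemma integral_rowsum_fin (I J : finType) (disp : measure_display)
    (T : measurableType disp) (P : probability T R) (X : I * J -> T -> RT)
    (x : J -> R) : iid_family D P X -> (\int[D]_y (`|y|)%:E < +oo)%E ->
  (\int[P]_t (rowsum x (fun k => X k t))%:E \is a fin_num)%E.
Proof.
move=> iidX fin; have mX := iidX.1.
have m_abs : measurable_fun [set: RT] (fun y => (`|y : R|)%:E).
  by apply/measurable_EFinP; exact: measurable_abs.
have mXabs k : measurable_fun setT (fun t => (`|X k t|)%:E).
  exact: measurableT_comp m_abs (mX k).
rewrite ge0_fin_numE; last by apply: integral_ge0 => t _; rewrite lee_fin rowsum_ge0.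
rewrite (integral_rowsumE _ iidX); apply: lte_sum_pinfty => i _.
apply: (@le_lt_trans _ _ (\int[P]_t \sum_j (`|x j|%:E * (`|X (i, j) t|)%:E)))%E.
  apply: ge0_le_integral => //.
  - apply/measurable_EFinP; apply: (measurableT_comp (f := fun y : R => `|y|)) => //.
    by apply: measurable_sum => j; apply: measurable_funM => //; exact: mX.
  - by apply: emeasurable_sum => j; apply: emeasurable_funM.
  - move=> t _; under [leRHS]eq_bigr do rewrite -EFinM.
    rewrite sumEFin lee_fin; apply: le_trans (ler_norm_sum _ _ _) _.
    by apply: ler_sum => j _; rewrite normrM mulrC.
rewrite ge0_integral_sum //; last by move=> j; apply: emeasurable_funM.
apply: lte_sum_pinfty => j _.
rewrite ge0_integralZl_EFin // (iid_marginal (f := fun y => (`|y : R|)%:E) _ iidX) //.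
by rewrite lte_mul_pinfty // ?lee_fin.
Qed.

End row_means.

Section power_law_concentration.
Context {R : realType} (p : R) (D : probability (measurableTypeR R) R).
Hypotheses (hp : 2 <= p) (hD : symmetric_power_law D p).
Local Notation RT := (measurableTypeR R).

Lemma power_law_abs_fin : (\int[D]_y (`|y|)%:E < +oo)%E.
Proof.
have [C C0 tail] := power_law_tail hp hD.
have hi := integral_trunc_hi (ltW C0) tail ltr01.
have lo := integral_trunc_lo (ltW C0) tail (lexx 1).
pose f (y : RT) : \bar R := (trunc_lo 1 y ^+ 2)%:E.
pose h (y : RT) : \bar R := (`|trunc_hi 1 y|)%:E.
have mf : measurable_fun setT f.
  by apply/measurable_EFinP; apply: measurable_funX; exact: measurable_trunc_lo.
have mh : measurable_fun setT h.
  apply/measurable_EFinP; apply: (measurableT_comp (f := fun y : R => `|y|)) => //.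
  exact: measurable_trunc_hi.
have f0 y : (0 <= f y)%E by rewrite lee_fin sqr_ge0.
have h0 y : (0 <= h y)%E by rewrite lee_fin.
apply: (@le_lt_trans _ _ (\int[D]_y (1 + (f y + h y)))%E).
  apply: ge0_le_integral => //.
  - by apply/measurable_EFinP; exact: measurable_abs.
  - by apply: emeasurable_funD => //; apply: emeasurable_funD.
  - move=> y _; rewrite -!EFinD lee_fin -[in leLHS](trunc_add 1 y) addrA.
    apply: le_trans (ler_normD _ _) _; rewrite lerD2r.
    rewrite -(real_normK (num_real _)); set a := `|_|.
    (* This gives [a <= 1 + a ^+ 2] for the small part. *)
    by have := sqr_ge0 (a - 2^-1); nra.
rewrite ge0_integralD //; last 2 first.
- by move=> y _; exact: adde_ge0.
- exact: emeasurable_funD.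
rewrite ge0_integralD // integral_cst // mul1e [X in (X + _)%E]probability_setT.
apply: lte_add_pinfty; first exact: ltry.
by apply: lte_add_pinfty; [exact: le_lt_trans lo (ltry _)
                          |exact: le_lt_trans hi (ltry _)].
Qed.

(* The truncation level [d / eps] makes the large entries negligible, while
   the second moment of the small ones is only logarithmic in it. *)
Lemma power_law_concentration (c : R) : 0 < c ->
  exists2 K : R, 0 < K &
    forall (I J : finType) (eps : R) (disp : measure_display)
      (T : measurableType disp) (P : probability T R)
      (X : I * J -> T -> RT) (u : nat -> J -> R),
    0 < eps -> eps < 1 / 2 -> (0 < #|J|)%N ->
    c * (#|J|%:R * Num.sqrt #|J|%:R * ln eps^-1) <= #|I|%:R * eps ^+ 2 ->
    iid_family D P X -> (forall k, \sum_j u k j ^+ 2 <= 1) ->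
    (P (\bigcup_k [set t | (K * eps * #|I|%:R < deviation P X u k t)%R]) <=
      (1 / 20)%:E)%E.
Proof.
move=> c0; have [C C0 tail] := power_law_tail hp hD.
have l2 : 0 < ln 2 :> R by rewrite ln_gt0 // ltr1n.
(* Chosen so that [v2 <= C2 * (Num.sqrt d * L)]: the first summand absorbs the constant part of
   [v2], the second its [ln M] part. *)
pose C2 := (1 + 4 * C) / ln 2 + 4 * C * (2 / ln 2 + 1) / ln 2.
have C20 : 0 < C2.
  rewrite addr_gt0 ?divr_gt0 ?addr_gt0 ?mulr_gt0 //.
  by rewrite addr_gt0 ?divr_gt0.
(* Here [80 = 4 * 20], from the factor of [deviation_countable] and the target probability. With
   [q = N eps] and [M = d / eps], the three terms bound [q / 2], the small entries and the large
   entries, each in units of [N eps]. *)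
pose K := 80 * (1 / 2 + C2 / (2 * c) + 4 * C).
have K0 : 0 < K.
  by rewrite mulr_gt0 // !addr_gt0 ?divr_gt0 ?mulr_gt0.
exists K => // I J eps disp T P X u e0 e2 J0 H iidX u1.
set d : R := #|J|%:R in H; set N : R := #|I|%:R in H *.
have d1 : 1 <= d by rewrite ler1n.
have d0 : 0 < d by apply: lt_le_trans d1.
have s1 : 1 <= Num.sqrt d by rewrite -sqrtr1 ler_wsqrtr.
set L := ln eps^-1 in H.
have Ll2 : ln 2 <= L.
  rewrite ler_ln ?posrE ?invr_gt0 // -[leLHS]invrK lef_pV2 ?posrE ?invr_gt0 //.
  by apply: ltW; move: e2; rewrite mul1r.
have L0 : 0 < L by apply: lt_le_trans Ll2.
have N0 : 0 < N.
  rewrite -(pmulr_lgt0 _ (exprn_gt0 2 e0)); apply: lt_le_trans H.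
  by rewrite mulr_gt0 // mulr_gt0 // mulr_gt0 // (lt_le_trans _ s1).
pose M := d / eps.
have M1 : 1 <= M by rewrite ler_pdivlMr // mul1r (le_trans _ d1) //; lra.
have M0 : 0 < M by apply: lt_le_trans M1.
have hi := integral_trunc_hi (ltW C0) tail M0.
have lo := integral_trunc_lo (ltW C0) tail M1.
set v2 := 1 + _ in lo; set v1 := 4 * C / M in hi.
(* The excess of [d^(3/2)] over [d] in the hypothesis pays for the [ln d] contained in [ln M]. *)
have lnd : ln d <= 2 * Num.sqrt d.
  have {1}-> : d = Num.sqrt d ^+ 2 by rewrite sqr_sqrtr // ltW.
  rewrite lnXn ?(lt_le_trans _ s1) // -[leLHS]mulr_natl ler_wpM2l //.
  apply: le_trans (_ : Num.sqrt d - 1 <= _); last by rewrite gerBl.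
  have := le_ln1Dx (x := Num.sqrt d - 1); rewrite addrCA subrr addr0; apply; lra.
have v2le : v2 <= C2 * (Num.sqrt d * L).
  have sL : ln 2 <= Num.sqrt d * L.
    by rewrite (le_trans Ll2) // ler_peMl // ltW.
  have lnM : ln M = ln d + L by rewrite lnM ?posrE ?invr_gt0.
  have b1 : 1 <= Num.sqrt d * L / ln 2 by rewrite ler_pdivlMr // mul1r.
  have b2 : ln d <= 2 / ln 2 * (Num.sqrt d * L).
    apply: le_trans lnd _; rewrite -mulrA ler_wpM2l // mulrC -mulrA.
    by rewrite ler_peMr ?(le_trans _ s1) // ler_pdivlMr // mul1r.
  have b3 : L <= Num.sqrt d * L by rewrite ler_peMl // ltW.
  have b4 : ln M / ln 2 <= (2 / ln 2 + 1) * (Num.sqrt d * L) / ln 2.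
    by rewrite ler_pM2r ?invr_gt0 // lnM mulrDl mul1r lerD.
  have C4 : 0 <= 4 * C by rewrite mulr_ge0 // ltW.
  have := ler_wpM2l C4 b4; have := ler_wpM2l C4 b1.
  rewrite /v2 /C2 => h1 h2.
  have -> : ((1 + 4 * C) / ln 2 + 4 * C * (2 / ln 2 + 1) / ln 2) *
     (Num.sqrt d * L) = (Num.sqrt d * L / ln 2) + 4 * C * (Num.sqrt d * L / ln 2)
       + 4 * C * ((2 / ln 2 + 1) * (Num.sqrt d * L) / ln 2).
    by field; rewrite gt_eqF.
  by rewrite mulrDr; lra.
have q0 : 0 < N * eps by rewrite mulr_gt0.
have fin k := integral_rowsum_fin (u k) iidX power_law_abs_fin.
have l0 : 0 < K * eps * N by rewrite mulr_gt0 // mulr_gt0.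
apply: le_trans (deviation_countable q0 lo hi iidX u1 fin l0) _.
rewrite lee_fin ler_pdivrMr //.
suff rle : @rad_mean R I J (N * eps) v1 v2 <=
    (1 / 2 + C2 / (2 * c) + 4 * C) * (N * eps).
  rewrite /K; have -> : 1 / 20 * (80 * (1 / 2 + C2 / (2 * c) + 4 * C) * eps * N) =
    4 * ((1 / 2 + C2 / (2 * c) + 4 * C) * (N * eps)) by field; rewrite gt_eqF.
  by rewrite ler_wpM2l.
have dv2 : d * v2 <= C2 / c * (N * eps ^+ 2).
  apply: le_trans (_ : d * (C2 * (Num.sqrt d * L)) <= _).
    by rewrite ler_wpM2l // ltW.
  have -> : d * (C2 * (Num.sqrt d * L)) =
    C2 / c * (c * (d * Num.sqrt d * L)) by field; rewrite gt_eqF.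
  by rewrite ler_wpM2l // divr_ge0 // ltW.
rewrite /rad_mean -/N -/d.
have -> : N * eps / 2 + N * (d * (v2 / (2 * (N * eps)) + v1)) =
    N * eps / 2 + (d * v2) / (2 * eps) + 4 * C * (N * eps).
  by rewrite /v1 /M; field; rewrite !gt_eqF.
have : (d * v2) / (2 * eps) <= C2 / c * (N * eps ^+ 2) / (2 * eps).
  by rewrite ler_wpM2r // invr_ge0 mulr_ge0 // ltW.
have -> : C2 / c * (N * eps ^+ 2) / (2 * eps) = C2 / (2 * c) * (N * eps).
  by field; rewrite !gt_eqF.
by rewrite !mulrDl; lra.
Qed.

End power_law_concentration.

(** * Row sampling *)

Section row_sampling.
Context {R : realType}.
Local Notation RT := (measurableTypeR R).

(** For [t <= 1/2], [(1 + 4 t) (1 - t) >= 1 + t], and always [(1 - 4 t) (1 + t) <= 1 - t]. *)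
Lemma relative_close (a b e t : R) : 0 <= a -> 0 <= b -> 0 <= t -> t <= 1 / 2 ->
  0 <= e -> `|a - e| <= t * e -> `|b - e| <= t * e ->
  (1 - 4 * t) * a <= b <= (1 + 4 * t) * a.
Proof.
move=> a0 b0 t0 t2 e0; rewrite !ler_norml => /andP[a1 a2] /andP[b1 b2].
apply/andP; split.
  have [t4|t4] := leP (1 - 4 * t) 0.
    by apply: le_trans b0; exact: mulr_le0_ge0.
  by nra.
by nra.
Qed.

(** For [t > 1/2], [2 (1 + t) <= 1 + 4 t], so knowing [a] up to a factor 2 is enough. *)
Lemma relative_upper (a b e t : R) : 0 <= a -> 1 / 2 < t -> b <= (1 + t) * e ->
  e / 2 <= a -> b <= (1 + 4 * t) * a.
Proof. by move=> a0 t2 be ea; nra. Qed.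

Lemma rowsumZ (I J : finType) (a : R) (x : J -> R) (z : I * J -> R) : 0 <= a ->
  rowsum (fun j => a * x j) z = a * rowsum x z.
Proof.
move=> a0; rewrite /rowsum mulr_sumr; apply: eq_bigr => i _.
rewrite -[a in RHS]ger0_norm // -normrM mulr_sumr; congr `|_|.
by apply: eq_bigr => j _; rewrite mulrCA.
Qed.

Lemma rowsum_inj_le (I1 I2 J : finType) (h : I2 -> I1) (x : J -> R)
    (z : I1 * J -> R) : injective h ->
  rowsum x (fun ij : I2 * J => z (h ij.1, ij.2)) <= rowsum x z.
Proof.
move=> hinj; rewrite /rowsum /=.
rewrite (bigID (fun i => i \in h @: [set: I2]%SET)) /= big_imset /=; last first.
  by move=> ? ? _ _; exact: hinj.
rewrite [X in _ <= X + _](eq_bigl predT) => [|i]; last by rewrite finset.in_setT.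
by rewrite lerDl sumr_ge0.
Qed.

Lemma rowsum_lipschitz (I J : finType) (x y : J -> R) (z : I * J -> R) (e : R) :
  (forall j, `|x j - y j| <= e) ->
  `|rowsum x z - rowsum y z| <= e * \sum_i \sum_j `|z (i, j)|.
Proof.
move=> xy; rewrite /rowsum -sumrB mulr_sumr.
apply: le_trans (ler_norm_sum _ _ _) _; apply: ler_sum => i _.
apply: le_trans (ler_dist_dist _ _) _; rewrite -sumrB mulr_sumr.
apply: le_trans (ler_norm_sum _ _ _) _; apply: ler_sum => j _.
by rewrite -mulrBr normrM mulrC ler_wpM2r.
Qed.

(** A countable dense set of directions, enumerated through [pickle]; numbers that encode no vector
    give 0. *)
Definition ratvec (d : nat) (k : nat) (j : 'I_d) : R :=
  if @unpickle {ffun 'I_d -> rat} k is Some q then ratr (q j) else 0.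

Lemma ratvec_dense (d : nat) (x : 'I_d -> R) (e : R) : 0 < e ->
  exists k, forall j, `|x j - @ratvec d k j| <= e.
Proof.
move=> e0.
have /choice[q qP] : forall j, exists q : rat, `|x j - ratr q| <= e.
  move=> j; have [|q] := @rat_in_itvoo _ (x j - e) (x j + e).
    by rewrite ltrD2l gtrN.
  rewrite in_itv /= => /andP[q1 q2]; exists q.
  by rewrite ler_norml; apply/andP; split; lra.
exists (pickle [ffun j => q j]) => j.
by rewrite /ratvec pickleK ffunE.
Qed.

(** Row sums are Lipschitz in [x]. The coefficients may have any sign, since [1 - K * eps] can be
    negative. *)
Lemma rowsum_le_dense (I1 I2 : finType) (d : nat) (a b : R)
    (z1 : I1 * 'I_d -> R) (z2 : I2 * 'I_d -> R) :
  (forall k, a * rowsum (@ratvec d k) z1 <= b * rowsum (@ratvec d k) z2) ->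
  forall x, a * rowsum x z1 <= b * rowsum x z2.
Proof.
move=> H x; apply/ler_addgt0Pr => e e0.
set S1 := \sum_i \sum_j `|z1 (i, j)|; set S2 := \sum_i \sum_j `|z2 (i, j)|.
have S10 : 0 <= S1 by apply: sumr_ge0 => i _; apply: sumr_ge0.
have S20 : 0 <= S2 by apply: sumr_ge0 => i _; apply: sumr_ge0.
pose c := `|a| * S1 + `|b| * S2 + 1.
have c0 : 0 < c by rewrite ltr_wpDl // addr_ge0 // mulr_ge0.
have [k kx] := ratvec_dense x (divr_gt0 e0 c0).
have h1 := rowsum_lipschitz z1 kx; have h2 := rowsum_lipschitz z2 kx.
rewrite -/S1 in h1; rewrite -/S2 in h2.
have l1 : a * rowsum x z1 - a * rowsum (ratvec k) z1 <= `|a| * (e / c * S1).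
  rewrite -mulrBr; apply: le_trans (ler_norm _) _.
  by rewrite normrM ler_wpM2l.
have l2 : b * rowsum (ratvec k) z2 - b * rowsum x z2 <= `|b| * (e / c * S2).
  rewrite -mulrBr; apply: le_trans (ler_norm _) _.
  by rewrite normrM distrC ler_wpM2l.
have : `|a| * (e / c * S1) + `|b| * (e / c * S2) <= e.
  have -> : `|a| * (e / c * S1) + `|b| * (e / c * S2) =
    e * ((c - 1) / c) by rewrite /c; field; rewrite gt_eqF.
  by rewrite ler_piMr ?(ltW e0) // ler_pdivrMr // mul1r gerBl.
have := H k; lra.
Qed.

Lemma l1norm_random_mx (disp : measure_display) (T : measurableType disp)
    (P : probability T R) (n d : nat)
    (A : 'I_n -> 'I_d -> {RV P >-> measurableTypeR R}) (t : T) (x : 'cV[R]_d) :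
  l1norm (random_mx A t *m x) =
    rowsum (fun j => x j 0) (fun ij => A ij.1 ij.2 t).
Proof.
apply: eq_bigr => i _; rewrite mxE; congr `|_|; apply: eq_bigr => j _.
by rewrite mxE.
Qed.

Lemma l1norm_sampling_mx (disp : measure_display) (T : measurableType disp)
    (P : probability T R) (n d r : nat)
    (A : 'I_n -> 'I_d -> {RV P >-> measurableTypeR R}) (t : T)
    (g : {ffun 'I_r -> 'I_n}) (x : 'cV[R]_d) :
  l1norm (sampling_mx R g *m random_mx A t *m x) = n%:R / r%:R *
    rowsum (fun j => x j 0) (fun ij : 'I_r * 'I_d => A (g ij.1) ij.2 t).
Proof.
rewrite -mulmxA /l1norm /rowsum mulr_sumr; apply: eq_bigr => k _.
rewrite mxE (bigD1 (g k)) //= big1 ?addr0; last first.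
  by move=> i ik; rewrite mxE eq_sym (negPf ik) mulr0 mul0r.
rewrite mxE eqxx mulr1 normrM ger0_norm ?divr_ge0 // mxE.
by congr (_ * `|_|); apply: eq_bigr => j _; rewrite mxE.
Qed.

Variables (p : R) (D : probability RT R).
Hypotheses (hp : 2 <= p) (hD : symmetric_power_law D p).

(** Both sums are compared with their common mean [En]. If [kap1 * eps <= 1/2], both concentrate at
    precision [eps]. Otherwise only the upper estimate has content: either [n] is large enough for
    concentration at the fixed precision [e0], so that the full sum is at least half its mean, or
    [n / r <= C] and the sampled sum is dominated by the full one. *)
Lemma fixed_sample (c1 : R) : 0 < c1 -> exists2 K : R, 0 < K &
  forall (n d r : nat) (eps : R) (disp : measure_display)
    (T : measurableType disp) (P : probability T R)
    (X : 'I_n * 'I_d -> T -> RT) (g : 'I_r -> 'I_n) (w : nat -> 'I_d -> R),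
  0 < eps -> eps < 1 / 2 -> (0 < d)%N ->
  c1 * (d%:R * Num.sqrt d%:R * ln eps^-1) <= r%:R * eps ^+ 2 ->
  iid_family D P X -> injective g ->
  exists B : set T, [/\ measurable B, (P B <= (1 / 10)%:E)%E &
    forall t, ~ B t -> forall k,
      (1 - K * eps) * rowsum (w k) (fun ij => X ij t) <=
        n%:R / r%:R * rowsum (w k) (fun ij : 'I_r * 'I_d => X (g ij.1, ij.2) t)
        <= (1 + K * eps) * rowsum (w k) (fun ij => X ij t)].
Proof.
move=> c10.
have [K1 K10 conc1] := power_law_concentration hp hD c10.
have [K0 K00 conc0] := power_law_concentration hp hD ltr01.
have mfin := power_law_abs_fin hp hD.
have m0 := power_law_abs_gt0 hp hD.
have l2 : 0 < ln 2 :> R by rewrite ln_gt0 // ltr1n.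
have [m mE] : exists m, (\int[D]_y (`|y|)%:E = m%:E)%E.
  exists (fine (\int[D]_y (`|y|)%:E)%E); rewrite fineK // ge0_fin_numE //.
  exact: ltW.
rewrite mE lte_fin in m0.
(* The factor [2 / m] turns an error in units of the number of rows into one relative to the mean,
   which is at least [m / 2] per row. *)
pose kap1 := 2 * K1 / m; pose kap0 := 2 * K0 / m.
have kap10 : 0 < kap1 by rewrite divr_gt0 // mulr_gt0.
have kap00 : 0 < kap0 by rewrite divr_gt0 // mulr_gt0.
pose e0 := Num.min (1 / 4) (1 / (2 * kap0)).
have e00 : 0 < e0 by rewrite lt_min !divr_gt0 // mulr_gt0.
have e04 : e0 < 1 / 2 by rewrite gt_min; apply/orP; left; lra.
have ke0 : kap0 * e0 <= 1 / 2.
  have -> : 1 / 2 = kap0 * (1 / (2 * kap0)) by field; rewrite gt_eqF.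
  by rewrite ler_wpM2l ?ge_min ?lexx ?orbT // ltW.
(* The bound on [n / r] when [n] is too small for precision [e0]: then [n * e0 ^+ 2] is below
   [d^(3/2) ln (1/e0)], while [r] is at least [c1 * ln 2 * d^(3/2)]. *)
pose C := ln e0^-1 / (e0 ^+ 2 * c1 * ln 2).
have C0 : 0 < C.
  rewrite divr_gt0 ?mulr_gt0 ?exprn_gt0 // ln_gt0 // -[ltLHS]invr1.
  by rewrite ltf_pV2 ?posrE //; lra.
(* The first term serves the two relative comparisons; the second makes [K * eps] exceed [C] as soon
   as [kap1 * eps > 1/2]. *)
pose K := 4 * kap1 + 2 * kap1 * C.
exists K; first by rewrite addr_gt0 // mulr_gt0 // mulr_gt0.
move=> n d r eps disp T P X g w eps0 eps2 d0 H iidX ginj.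
have d1 : 1 <= d%:R :> R by rewrite ler1n.
have s1 : 1 <= Num.sqrt d%:R :> R by rewrite -[leLHS]sqrtr1 ler_wsqrtr.
have dd0 : 0 < d%:R * Num.sqrt d%:R :> R.
  by rewrite mulr_gt0 ?(lt_le_trans _ d1) ?(lt_le_trans _ s1).
have Ll2 : ln 2 <= ln eps^-1.
  rewrite ler_ln ?posrE ?invr_gt0 // -[leLHS]invrK lef_pV2 ?posrE ?invr_gt0 //.
  by apply: ltW; move: eps2; rewrite mul1r.
have r0 : 0 < r%:R :> R.
  rewrite -(pmulr_lgt0 _ (exprn_gt0 2 eps0)); apply: lt_le_trans H.
  by rewrite mulr_gt0 // mulr_gt0 // (lt_le_trans l2).
have rn : r%:R <= n%:R :> R.
  by rewrite ler_nat -[r]card_ord -[n]card_ord; exact: leq_card ginj.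
have n0 : 0 < n%:R :> R by exact: lt_le_trans rn.
have Hn : c1 * (d%:R * Num.sqrt d%:R * ln eps^-1) <= n%:R * eps ^+ 2.
  by apply: le_trans H _; rewrite ler_wpM2r // exprn_ge0 // ltW.
pose Y (ij : 'I_r * 'I_d) := X (g ij.1, ij.2).
have iidY : iid_family D P Y.
  apply: (iid_inj (h := fun ij : 'I_r * 'I_d => (g ij.1, ij.2)) _ iidX).
  by move=> [i j] [i' j'] [/ginj -> ->].
pose nw k := Num.sqrt (\sum_j w k j ^+ 2).
(* Division by zero gives 0, so a zero vector is normalized to 0 and [wE] still holds. *)
pose u k j := w k j / nw k.
have nw2 k : nw k ^+ 2 = \sum_j w k j ^+ 2.
  by rewrite sqr_sqrtr // sumr_ge0 // => j _; rewrite sqr_ge0.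
have usum k : nw k != 0 -> \sum_j u k j ^+ 2 = 1.
  move=> nwk; under eq_bigr do rewrite expr_div_n.
  by rewrite -mulr_suml -nw2 divff // expf_neq0.
have u1 k : \sum_j u k j ^+ 2 <= 1.
  have [nwk|/usum ->//] := eqVneq (nw k) 0.
  by rewrite big1 // => j _; rewrite /u nwk invr0 mulr0 expr0n.
have wE (I : finType) k (z : I * 'I_d -> R) :
    rowsum (w k) z = nw k * rowsum (u k) z.
  have nwk0 : 0 <= nw k by exact: sqrtr_ge0.
  rewrite -rowsumZ //; congr rowsum; apply/funext => j.
  rewrite /u mulrC -mulrA; have [nwk|nwk] := eqVneq (nw k) 0; last first.
    by rewrite mulVf ?mulr1.
  rewrite nwk mulr0 mulr0; apply/eqP.
  move: (nw2 k); rewrite nwk expr0n /= => /esym/eqP.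
  rewrite psumr_eq0 => [/allP/(_ j)|i _]; last by rewrite sqr_ge0.
  by rewrite mem_index_enum sqrf_eq0; apply.
pose En k := fine (\int[P]_t (rowsum (u k) (fun ij => X ij t))%:E)%E.
pose Er k := fine (\int[P]_t (rowsum (u k) (fun ij => Y ij t))%:E)%E.
have EnE k : (\int[P]_t (rowsum (u k) (fun ij => X ij t))%:E = (En k)%:E)%E.
  by rewrite fineK // (integral_rowsum_fin _ iidX mfin).
have ErE k : (\int[P]_t (rowsum (u k) (fun ij => Y ij t))%:E = (Er k)%:E)%E.
  by rewrite fineK // (integral_rowsum_fin _ iidY mfin).
have Enr k : n%:R / r%:R * Er k = En k.
  have := integral_rowsum_card (u k) iidX iidY.
  rewrite EnE ErE !card_ord -!EFinM => -[e].
  by rewrite mulrAC -e mulrAC divff ?mul1r // gt_eqF.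
have Enm k : nw k != 0 -> n%:R / 2 * m <= En k.
  move=> /usum uk; have := integral_rowsum_ge iidX hD.1 uk.
  by rewrite EnE mE card_ord -EFinM lee_fin.
have dev_n (c e : R) k t : nw k != 0 -> 0 < c -> 0 < e ->
    ~ (c * e * n%:R < deviation P X u k t) ->
    `|rowsum (u k) (fun ij => X ij t) - En k| <= 2 * c / m * e * En k.
  move=> /Enm Ek c0 ee /negP; rewrite -leNgt => /le_trans; apply.
  have -> : c * e * n%:R = 2 * c / m * e * (n%:R / 2 * m) by field; rewrite gt_eqF.
  by rewrite ler_wpM2l // mulr_ge0 ?(ltW ee) // divr_ge0 ?mulr_ge0 // ltW.
have dev_r k t : nw k != 0 -> ~ (K1 * eps * r%:R < deviation P Y u k t) ->
    `|n%:R / r%:R * rowsum (u k) (fun ij => Y ij t) - En k| <= kap1 * eps * En k.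
  move=> /Enm Ek /negP; rewrite -leNgt => dv.
  rewrite -Enr -mulrBr normrM ger0_norm; last by rewrite divr_ge0 // ltW.
  apply: (@le_trans _ _ (n%:R / r%:R * (K1 * eps * r%:R))).
    by rewrite ler_wpM2l // divr_ge0 // ltW.
  have -> : n%:R / r%:R * (K1 * eps * r%:R) = kap1 * eps * (n%:R / 2 * m).
    by rewrite /kap1; field; rewrite !gt_eqF.
  by rewrite Enr ler_wpM2l // mulr_ge0 // ltW.
pose Bad (I : finType) (Z : I * 'I_d -> T -> RT) (l : R) :=
  \bigcup_k [set t | l < deviation P Z u k t].
have mBad (I : finType) (Z : I * 'I_d -> T -> RT) l :
    iid_family D P Z -> measurable (Bad I Z l).
  move=> iidZ; apply: bigcup_measurable => k _.
  exact: (measurable_deviation_gt iidZ u l k).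
have PB1 := conc1 _ _ eps disp T P Y u eps0 eps2.
rewrite !card_ord in PB1; have {}PB1 := PB1 d0 H iidY u1.
have half (B1 B2 : set T) : measurable B1 -> measurable B2 ->
    (P B1 <= (1 / 20)%:E)%E -> (P B2 <= (1 / 20)%:E)%E ->
    (P (B1 `|` B2) <= (1 / 10)%:E)%E.
  move=> m1 m2 p1 p2; apply: le_trans (measureU2 _ m1 m2) _.
  by apply: le_trans (leeD p1 p2) _; rewrite -EFinD lee_fin; lra.
have reduce (t : T) k :
    (nw k != 0 ->
      (1 - K * eps) * rowsum (u k) (fun ij => X ij t) <=
        n%:R / r%:R * rowsum (u k) (fun ij => Y ij t)
        <= (1 + K * eps) * rowsum (u k) (fun ij => X ij t)) ->
    (1 - K * eps) * rowsum (w k) (fun ij => X ij t) <=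
        n%:R / r%:R * rowsum (w k) (fun ij => Y ij t)
        <= (1 + K * eps) * rowsum (w k) (fun ij => X ij t).
  rewrite !wE; have [->|nwk /(_ isT)] := eqVneq (nw k) 0.
    by rewrite !mul0r !mulr0 lexx.
  have nw0 : 0 <= nw k by exact: sqrtr_ge0.
  rewrite ![_ * (nw k * _)]mulrCA => /andP[h1 h2].
  by rewrite !ler_wpM2l.
have Rn0 k t : 0 <= rowsum (u k) (fun ij => X ij t) by exact: rowsum_ge0.
have Rr0 k t : 0 <= n%:R / r%:R * rowsum (u k) (fun ij => Y ij t).
  by rewrite mulr_ge0 ?rowsum_ge0 // divr_ge0 // ltW.
have En0 k : nw k != 0 -> 0 <= En k.
  by move=> /Enm; apply: le_trans; rewrite mulr_ge0 ?divr_ge0 // ltW.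
have Keps : 4 * (kap1 * eps) <= K * eps.
  have kC : 0 < 2 * kap1 * C by rewrite mulr_gt0 // mulr_gt0.
  by rewrite mulrA ler_pM2r // lerDl ltW.
have [small|large] := leP (kap1 * eps) (1 / 2).
  have PB2 := conc1 _ _ eps disp T P X u eps0 eps2.
  rewrite !card_ord in PB2; have {}PB2 := PB2 d0 Hn iidX u1.
  exists (Bad _ Y (K1 * eps * r%:R) `|` Bad _ X (K1 * eps * n%:R)); split.
  - by apply: measurableU; exact: mBad.
  - by apply: half => //; exact: mBad.
  move=> t nB k; apply: reduce => nwk.
  have hr : ~ (K1 * eps * r%:R < deviation P Y u k t)
    by move=> ?; apply: nB; left; exists k.
  have hn : ~ (K1 * eps * n%:R < deviation P X u k t)
    by move=> ?; apply: nB; right; exists k.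
  have /andP[h1 h2] := relative_close (Rn0 k t) (Rr0 k t)
    (mulr_ge0 (ltW kap10) (ltW eps0)) small (En0 k nwk)
    (dev_n _ _ _ _ nwk K10 eps0 hn) (dev_r _ _ nwk hr).
  apply/andP; split; [apply: le_trans h1|apply: le_trans h2 _];
    by rewrite ler_wpM2r // ?lerD2l ?lerN2.
(* Now [K * eps > 1], so the left-hand side is not positive. *)
have lower k t : (1 - K * eps) * rowsum (u k) (fun ij => X ij t) <=
    n%:R / r%:R * rowsum (u k) (fun ij => Y ij t).
  apply: le_trans (Rr0 k t); rewrite mulr_le0_ge0 //; lra.
have [Hn0|Hn0] := leP (1 * (d%:R * Num.sqrt d%:R * ln e0^-1)) (n%:R * e0 ^+ 2).
  have PB2 := conc0 _ _ e0 disp T P X u e00 e04.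
  rewrite !card_ord in PB2; have {}PB2 := PB2 d0 Hn0 iidX u1.
  exists (Bad _ Y (K1 * eps * r%:R) `|` Bad _ X (K0 * e0 * n%:R)); split.
  - by apply: measurableU; exact: mBad.
  - by apply: half => //; exact: mBad.
  move=> t nB k; apply: reduce => nwk; rewrite lower /=.
  have hr : ~ (K1 * eps * r%:R < deviation P Y u k t)
    by move=> ?; apply: nB; left; exists k.
  have hn : ~ (K0 * e0 * n%:R < deviation P X u k t)
    by move=> ?; apply: nB; right; exists k.
  have := dev_n _ _ _ _ nwk K00 e00 hn; rewrite -/kap0 ler_norml => /andP[dn _].
  have := dev_r _ _ nwk hr; rewrite ler_norml => /andP[_ dr].
  have E2 : En k / 2 <= rowsum (u k) (fun ij => X ij t).
    have := ler_wpM2r (En0 k nwk) ke0; lra.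
  apply: le_trans (relative_upper (Rn0 k t) large (e := En k) _ E2) _.
    by move: dr; rewrite mulrDl mul1r; lra.
  by rewrite ler_wpM2r // lerD2l.
(* In this last case the estimate is deterministic and no event is removed. *)
exists set0; split => //; first by rewrite measure0 lee_fin.
move=> t _ k; apply: reduce => nwk; rewrite lower /=.
have nr : n%:R / r%:R <= C.
  rewrite ler_pdivrMr //.
  have e02 : 0 < e0 ^+ 2 by rewrite exprn_gt0.
  have le1 : d%:R * Num.sqrt d%:R * (c1 * ln 2) <= r%:R.
    apply: (@le_trans _ _ (r%:R * eps ^+ 2)); last first.
      by rewrite ler_piMr ?(ltW r0) // exprn_ile1 ?(ltW eps0) //; lra.
    apply: le_trans H; rewrite mulrCA ler_pM2l // ler_pM2l //.
  rewrite mul1r in Hn0.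
  rewrite -(ler_pM2r e02); apply: le_trans (ltW Hn0) _.
  have -> : C * r%:R * e0 ^+ 2 = ln e0^-1 * (r%:R / (c1 * ln 2)).
    by rewrite /C; field; rewrite !gt_eqF.
  rewrite mulrC ler_wpM2l //; last by rewrite ler_pdivlMr // mulr_gt0.
  by rewrite ln_ge0 // -[leLHS]invr1 lef_pV2 ?posrE //; lra.
apply: (@le_trans _ _ (C * rowsum (u k) (fun ij => X ij t))).
  rewrite ler_pM ?divr_ge0 ?rowsum_ge0 ?(ltW n0) ?(ltW r0) //.
  exact: (rowsum_inj_le _ _ ginj).
rewrite ler_wpM2r //.
have := ler_wpM2r (ltW C0) (ltW large); rewrite /K mulrDl.
have : 0 < 4 * kap1 * eps by rewrite mulr_gt0 // mulr_gt0.
lra.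
Qed.

End row_sampling.

(** * Conditioning on the sample *)

Section conditioning.
Context {R : realType}.
Local Notation RT := (measurableTypeR R).

(* The product of the two lower bounds [r^(1/p) >= c1^(1/p) / eps] and
   [r^(1-1/p) >= c1^(1-1/p) * d^(3/2+1/p) * ln (1/eps) / eps]. *)
Lemma sample_size_ge (p c1 eps r : R) (d : nat) : 2 <= p -> 0 < c1 ->
  0 < eps -> eps < 1 / 2 -> (0 < d)%N -> c1 * sample_size p d eps <= r ->
  c1 * (d%:R * Num.sqrt d%:R * ln eps^-1) <= r * eps ^+ 2.
Proof.
move=> hp c10 e0 e2 d0 H.
have p0 : 0 < p by apply: lt_le_trans hp.
have p1 : 0 < p - 1 by lra.
have d1 : 1 <= d%:R :> R by rewrite ler1n.
have L0 : 0 <= ln eps^-1.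
  by rewrite ln_ge0 // -[leLHS]invr1 lef_pV2 ?posrE //; lra.
set base := d%:R `^ (3 / 2 + p^-1) * eps^-1 * ln eps^-1.
have base0 : 0 <= base by rewrite mulr_ge0 // mulr_ge0 ?powR_ge0 // invr_ge0 ltW.
pose rho := r / c1.
have ss_le : sample_size p d eps <= rho by rewrite ler_pdivlMr // mulrC.
have a_le : eps `^ (- p) <= rho.
  by apply: le_trans ss_le; rewrite le_max lexx.
have b_le : base `^ (p / (p - 1)) <= rho.
  by apply: le_trans ss_le; rewrite le_max lexx orbT.
have rho0 : 0 < rho by apply: lt_le_trans a_le; exact: powR_gt0.
have a1 : eps^-1 <= rho `^ p^-1.
  have -> : eps^-1 = (eps `^ (- p)) `^ p^-1.
    by rewrite -powRrM mulNr divff ?gt_eqF // powR_inv1 // ltW.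
  by apply: ge0_ler_powR; rewrite ?nnegrE ?powR_ge0 ?(ltW rho0) // invr_ge0 ltW.
have b1 : base <= rho `^ ((p - 1) / p).
  have {1}-> : base = (base `^ (p / (p - 1))) `^ ((p - 1) / p).
    rewrite -powRrM (_ : p / (p - 1) * ((p - 1) / p) = 1) ?powRr1 //.
    by field; rewrite !gt_eqF.
  apply: ge0_ler_powR; rewrite ?nnegrE ?powR_ge0 ?(ltW rho0) //.
  by rewrite divr_ge0 // ltW.
have rhoE : rho = rho `^ p^-1 * rho `^ ((p - 1) / p).
  rewrite -powRD; last by rewrite (gt_eqF rho0) implybT.
  rewrite (_ : p^-1 + (p - 1) / p = 1) ?powRr1 ?(ltW rho0) //.
  by field; rewrite gt_eqF.
have d_le : d%:R * Num.sqrt d%:R <= d%:R `^ (3 / 2 + p^-1) :> R.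
  have -> : d%:R * Num.sqrt d%:R = d%:R `^ (3 / 2) :> R.
    rewrite -powR12_sqrt // -{1}[d%:R]powRr1 // -powRD.
      by congr (_ `^ _); lra.
    by rewrite (gt_eqF (lt_le_trans _ d1)) // implybT.
  by rewrite ler_powR // lerDl invr_ge0 ltW.
have main : d%:R * Num.sqrt d%:R * ln eps^-1 <= rho * eps ^+ 2.
  apply: (@le_trans _ _ (eps^-1 * base * eps ^+ 2)); last first.
    rewrite ler_wpM2r ?exprn_ge0 ?(ltW e0) // rhoE.
    by rewrite ler_pM // invr_ge0 ltW.
  have -> : eps^-1 * base * eps ^+ 2 = d%:R `^ (3 / 2 + p^-1) * ln eps^-1.
    by rewrite /base; field; rewrite gt_eqF.
  by rewrite ler_wpM2r.
have -> : r * eps ^+ 2 = c1 * (rho * eps ^+ 2).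
  by rewrite /rho; field; rewrite gt_eqF.
by rewrite ler_wpM2l // ltW.
Qed.

(** Joint independence makes the probability of a box of entries together with [s = g] factor, and
    normalizing cancels the mass of [s = g]. The last argument [P] of [mnormalize] is a fallback,
    excluded by the nonzero mass. *)
Lemma conditional_iid (D : probability RT R) (disp : measure_display)
    (T : measurableType disp) (P : probability T R) (n d r : nat)
    (A : 'I_n -> 'I_d -> {RV P >-> measurableTypeR R})
    (s : T -> {ffun 'I_r -> 'I_n}) (g : {ffun 'I_r -> 'I_n})
    (mS : measurable (s @^-1` [set g])) :
  iid_entries_indep_sample D A s -> P (s @^-1` [set g]) != 0%E ->
  iid_family D (mnormalize (mrestr P mS) P)
    (fun (ij : 'I_n * 'I_d) => A ij.1 ij.2 : T -> RT).
Proof.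
move=> [law ind] PS0; split=> [ij|B mB]; first exact: measurable_funP.
pose S := s @^-1` [set g].
pose E (k : option ('I_n * 'I_d)) : set T :=
  if k is Some ij then A ij.1 ij.2 @^-1` B ij else S.
have := ind [set: option ('I_n * 'I_d)]%SET E.
have -> : \bigcap_(k in [set` [set: option ('I_n * 'I_d)]%SET]) E k =
    (\bigcap_ij (A ij.1 ij.2 @^-1` B ij)) `&` S.
  apply/seteqP; split=> [t Et|t [At St] [ij|] _].
  - split=> [ij _|]; first by have := Et (Some ij); apply; rewrite /= inE.
    by have := Et None; apply; rewrite /= inE.
  - exact: At.
  - exact: St.
move=> indE; have {}indE := indE _.
have Sfin : P S \is a fin_num by exact: fin_num_measure.
rewrite /= /mnormalize /= /mrestr setTI -/S (negPf PS0) /=.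
have -> : (P S == +oo)%E = false.
  by apply/negbTE; move: Sfin; rewrite fin_numE => /andP[].
rewrite indE => [|[ij|] _]; last 2 first.
- by exists (B ij); rewrite ?setTI.
- by exists [set g]; rewrite ?setTI.
rewrite -EFinM; congr EFin.
rewrite (bigD1 None) ?finset.in_setT //= mulrAC divff ?mul1r; last first.
  by rewrite fine_eq0.
rewrite (reindex_omap Some id) /=; last by case=> // /andP[].
apply: eq_big => [ij|ij _]; first by rewrite finset.in_setT /= eqxx.
by congr fine; have := law ij.1 ij.2 (B ij) (mB ij).
Qed.

End conditioning.

Theorem theorem6p23 (R : realType) (p : R) (hp : 2 <= p)
    (D : probability (measurableTypeR R) R) (hD : symmetric_power_law D p)
    (c1 c2 : R) (hc1 : 0 < c1) (hc2 : 0 < c2) :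
  exists2 K : R, 0 < K &
    forall (n d r : nat) (eps : R),
      0 < eps -> eps < 1 / 2 ->
      c1 * sample_size p d eps <= r%:R ->
      r%:R <= c2 * sample_size p d eps ->
    forall (disp : measure_display) (T : measurableType disp)
      (P : probability T R)
      (A : 'I_n -> 'I_d -> {RV P >-> measurableTypeR R})
      (s : T -> {ffun 'I_r -> 'I_n}),
      uniform_row_sample P s ->
      iid_entries_indep_sample D A s ->
      ((9 / 10 : R)%:E <=
        P [set t : T | forall x : 'cV[R]_d,
             ((1 - K * eps) * l1norm (random_mx A t *m x)
               <= l1norm (sampling_mx R (s t) *m random_mx A t *m x)
               <= (1 + K * eps) * l1norm (random_mx A t *m x))%R])%E.
Proof.
have [K K0 fixed] := fixed_sample hp hD hc1.
exists K => // n d r eps e0 e2 H _ disp T P A s unif indep.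
set E := [set t : T | _].
(* Without columns both norms vanish. *)
have [d0|d0] := posnP d.
  have -> : E = setT.
    apply/seteqP; split=> // t _ x; subst d.
    have l0 m : l1norm (0 : 'cV[R]_m) = 0.
      by rewrite /l1norm big1 // => i _; rewrite mxE normr0.
    by rewrite (flatmx0 x) !mulmx0 !l0 !mulr0 lexx.
  by rewrite probability_setT lee_fin; lra.
have Hr := sample_size_ge hp hc1 e0 e2 d0 H.
pose S g := s @^-1` [set g].
pose ineq (g : {ffun 'I_r -> 'I_n}) (x : 'I_d -> R) t :=
  (1 - K * eps) * rowsum x (fun ij => A ij.1 ij.2 t) <=
    n%:R / r%:R * rowsum x (fun ij : 'I_r * 'I_d => A (g ij.1) ij.2 t)
    <= (1 + K * eps) * rowsum x (fun ij => A ij.1 ij.2 t).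
pose good g := \bigcap_k [set t | ineq g (@ratvec R d k) t].
have mS g : measurable (S g) by have [] := unif g.
have mA i j : measurable_fun setT (A i j : T -> measurableTypeR R).
  exact: measurable_funP.
have mgood g : measurable (good g).
  apply: bigcapT_measurable => k.
  have mn : measurable_fun setT
      (fun t => rowsum (@ratvec R d k) (fun ij => A ij.1 ij.2 t)).
    apply: (measurable_rowsum (Z := fun ij t => A ij.1 ij.2 t)) => ij.
    exact: mA.
  have mr : measurable_fun setT (fun t => rowsum (@ratvec R d k)
      (fun ij : 'I_r * 'I_d => A (g ij.1) ij.2 t)).
    apply: (measurable_rowsum (Z := fun ij t => A (g ij.1) ij.2 t)) => ij.
    exact: mA.
  have -> : [set t | ineq g (@ratvec R d k) t] =
    [set t | (1 - K * eps) * rowsum (@ratvec R d k) (fun ij => A ij.1 ij.2 t) <=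
      n%:R / r%:R * rowsum (@ratvec R d k)
        (fun ij : 'I_r * 'I_d => A (g ij.1) ij.2 t)] `&`
    [set t | n%:R / r%:R * rowsum (@ratvec R d k)
        (fun ij : 'I_r * 'I_d => A (g ij.1) ij.2 t) <=
      (1 + K * eps) * rowsum (@ratvec R d k) (fun ij => A ij.1 ij.2 t)].
    by apply/seteqP; split=> t; [move=> /andP[]|move=> [? ?]; apply/andP].
  by apply: measurableI; rewrite -[X in measurable X]setTI;
    apply: measurable_fun_le => //; apply: measurable_funM.
(* Splitting by the value of the sample and restricting to rational vectors writes the event as a
   finite disjoint union of measurable sets. *)
have EE : E = \bigcup_g (S g `&` good g).
  apply/seteqP; split=> [t Et|t [g _ [Sg gt]] x].
    exists (s t) => //; split=> // k _.
    have := Et (\col_j @ratvec R d k j).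
    rewrite l1norm_sampling_mx l1norm_random_mx /ineq.
    by under eq_fun do rewrite mxE.
  rewrite Sg l1norm_sampling_mx l1norm_random_mx; apply/andP; split.
    by apply: rowsum_le_dense => k; have /andP[] := gt k I.
  by apply: rowsum_le_dense => k; have /andP[] := gt k I.
have trivS : trivIset setT S.
  by move=> g h _ _ [t [<- <-]].
have SE : \bigcup_g S g = setT.
  by apply/seteqP; split=> // t _; exists (s t).
have each g : ((9 / 10)%:E * P (S g) <= P (S g `&` good g))%E.
  have [PS0|PS0] := eqVneq (P (S g)) 0%E; first by rewrite PS0 mule0.
  (* Values of positive mass are injections, so the sampled rows are distinct rows of the matrix. *)
  have ginj : injective g.
    apply/injectiveP; apply: contraNT PS0 => ng.
    by rewrite /S; have [_ ->] := unif g; rewrite (negPf ng).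
  have iidQ := @conditional_iid R D disp T P n d r A s g (mS g) indep PS0.
  have [B [mB QB Bgood]] := fixed _ _ _ _ _ _ _ _ g (@ratvec R d) e0 e2 d0 Hr
    iidQ ginj.
  (* The conditional bound on [B], multiplied back by the mass of [S g]. *)
  have cB : (P (B `&` S g) <= (1 / 10)%:E * P (S g))%E.
    have PSfin : P (S g) \is a fin_num by exact: fin_num_measure.
    move: QB; rewrite /= /mnormalize /= /mrestr setTI -/(S g) (negPf PS0) /=.
    have -> : (P (S g) == +oo)%E = false.
      by apply/negbTE; move: PSfin; rewrite fin_numE => /andP[].
    rewrite lee_pdivrMr ?fineK //.
    by rewrite fine_gt0 // lt0e PS0 measure_ge0 -ge0_fin_numE.
  have sub : S g `\` B `<=` S g `&` good g.
    move=> t [St nB]; split=> // k _.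
    exact: Bgood.
  apply: (@le_trans _ _ (P (S g `\` B))); last first.
    apply: le_measure sub; rewrite inE; first exact: measurableD.
    exact: measurableI.
  have Pfin U : measurable U -> P U \is a fin_num.
    by move=> mU; exact: fin_num_measure.
  have SgE : (P (S g) = P (B `&` S g) + P (S g `\` B))%E.
    rewrite [in RHS]setIC -measureU //; last first.
    - by apply/seteqP; split=> // t [[_ Bt] [_ nB]].
    - exact: measurableD.
    - exact: measurableI.
    by rewrite setUIDK.
  move: SgE cB; rewrite -(fineK (Pfin _ (mS g))).
  rewrite -(fineK (Pfin _ (measurableI _ _ mB (mS g)))).
  rewrite -(fineK (Pfin _ (measurableD (mS g) mB))) -EFinD -!EFinM.
  by rewrite !lee_fin => -[->]; lra.
rewrite EE measure_fin_bigcup //.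
- apply: (@le_trans _ _ (\sum_(g \in [set: {ffun 'I_r -> 'I_n}])
      ((9 / 10)%:E * P (S g)))%E); last first.
    by apply: lee_fsum => [|g _]; [exact: finite_finset|exact: each].
  rewrite -ge0_mule_fsumr //.
  have := measure_fin_bigcup P finite_finset trivS (fun g _ => mS g).
  by rewrite SE [LHS]probability_setT => <-; rewrite mule1.
- exact: finite_finset.
- by move=> g h _ _ [t [[<- _] [<- _]]].
- by move=> g _; apply: measurableI.
Qed.
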